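(* Let $(R,\mathfrak m)$ be a Cohen-Macaulay local ring of dimension one, and let $I$ be an $\mathfrak m$-primary ideal of $R$. (1) Suppose that all $\mathfrak m$-primary ideals of $R$ have a principal reduction (for example, the residue field $R/\mathfrak m$ is infinite, or $\overline{R}$ is local with the same residue field as that of $R$). Then $I$ is a partial trace ideal of some $R$-module if and only if $R:I\subseteq \overline{R}$. (2) Suppose that $\overline{R}$ is a discrete valuation ring with maximal ideal $\mathfrak n$ and $R/\mathfrak m\cong \overline{R}/\mathfrak n$. Suppose that $J$ is a partial trace ideal of $I$. Then $$\{\text{partial trace ideals of } I\}=\{\alpha J\mid \alpha\in R:J,\ v(\alpha)=0\}.$$
   Context: All rings are commutative Noetherian and all modules are finitely generated. $\mathrm{Q}(R)$ is the total quotient ring of $R$ and $\overline{R}$ the integral closure of $R$ in $\mathrm{Q}(R)$. For an ideal $I$ containing a non-zerodivisor, $R:I=\{\alpha\in \mathrm{Q}(R)\mid \alpha I\subseteq R\}$. A principal reduction of an ideal $K$ is a principal ideal $(a)\subseteq K$ with $K^{n+1}=aK^n$ for some $n\ge 0$. For an $R$-module $M$, $h(M)=\inf\{\ell_R(R/\operatorname{Im} f)\mid f\in \operatorname{Hom}_R(M,R)\}$; an ideal $J$ is a partial trace ideal of $M$ if $J=\operatorname{Im} f$ for some $f\in \operatorname{Hom}_R(M,R)$ and $\ell_R(R/J)=h(M)$. The isomorphism $R/\mathfrak m\cong\overline{R}/\mathfrak n$ is the one induced by the inclusion $R\subseteq\overline{R}$. When $\overline{R}$ is a discrete valuation ring,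 $v:\mathrm{Q}(R)\to\mathbb{Z}\cup\{\infty\}$ is the normalized valuation of $\overline{R}$: $v(a/b)=\ell_{\overline{R}}(\overline{R}/a\overline{R})-\ell_{\overline{R}}(\overline{R}/b\overline{R})$ for $a,b\in R$ with $b$ a non-zerodivisor. *)

(* Defs.v *)
From HB Require Import structures.
From mathcomp Require Import all_boot all_order all_algebra.
From mathcomp Require Import mathcomp_extra boolp classical_sets functions.
From mathcomp Require Import constructive_ereal.

Set Implicit Arguments.
Unset Strict Implicit.
Unset Printing Implicit Defensive.

Import Order.TTheory GRing.Theory Num.Theory.
Import Quotient.

Local Open Scope quotient_scope.
Local Open Scope classical_set_scope.
Local Open Scope ring_scope.

(* Suprema and infima of sets of natural numbers, possibly infinite, are taken
   in [\bar int].  [chain_sup P] is the supremum of the n such that there is a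
   chain c 0 < c 1 < ... < c n of members of P; it is -oo only if P is empty. *)
Definition chain_sup (T : Type) (P : set (set T)) : \bar int :=
  supremum (-oo)%E
    [set z | exists n : nat, z = (n%:Z)%:E /\
       exists c : nat -> set T,
         (forall i, (i <= n)%N -> P (c i)) /\
         (forall i, (i < n)%N -> c i `<` c i.+1)].

Section Modules.
Variables (R : comNzRingType) (V : lmodType R).

Definition is_submodule (N : set V) : Prop := submod_closed (mem N).

Definition mlength : \bar int := chain_sup is_submodule.

Definition mspan (s : seq V) : set V :=
  [set v | exists c : 'I_(size s) -> R, v = \sum_(i < size s) c i *: s`_i].

Definition finitely_generated : Prop := exists s : seq V, mspan s = [set: V].

End Modules.
Arguments mlength {R} V.
Arguments finitely_generated {R} V.

Section QuotientModule.
Variables (R : comNzRingType) (V : lmodType R) (N : submodClosed V).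

(* Quotients in [ring_quotient] need a [zmodClosed] predicate, a structure from
   which [submodClosed] does not inherit. *)
Definition zmod_of : {pred V} := [in N].

Fact zmod_of_closed : zmod_closed zmod_of.
Proof. exact: GRing.submod_closedB (submodClosedP N). Qed.
HB.instance Definition _ := GRing.isZmodClosed.Build V zmod_of zmod_of_closed.

Definition mquot : Type := {quot zmod_of}.
HB.instance Definition _ := GRing.Zmodule.on mquot.
HB.instance Definition _ := EqQuotient.on mquot.

Definition mquot_scale (a : R) (x : mquot) : mquot := \pi_mquot (a *: repr x).

Fact pi_mquotD u v : \pi_mquot (u + v) = \pi_mquot u + \pi_mquot v.
Proof. by rewrite (@pi_add _ zmod_of). Qed.

Fact pi_mquot_scale a v : mquot_scale a (\pi_mquot v) = \pi_mquot (a *: v).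
Proof.
apply/eqP; rewrite /mquot_scale -(@idealrBE _ zmod_of) -scalerBr.
have : repr (\pi_mquot v) - v \in zmod_of.
  by rewrite (@idealrBE _ zmod_of) reprK eqxx.
exact: (@rpredZ _ _ N).
Qed.

Fact mquot_scalerA a b x :
  mquot_scale a (mquot_scale b x) = mquot_scale (a * b) x.
Proof. by elim/(@quotW _ mquot): x => v; rewrite !pi_mquot_scale scalerA. Qed.

Fact mquot_scale1r : left_id 1 mquot_scale.
Proof. by elim/(@quotW _ mquot) => v; rewrite pi_mquot_scale scale1r. Qed.

Fact mquot_scalerDr : right_distributive mquot_scale +%R.
Proof.
move=> a; elim/(@quotW _ mquot) => u; elim/(@quotW _ mquot) => v.
by rewrite -pi_mquotD !pi_mquot_scale -pi_mquotD scalerDr.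
Qed.

Fact mquot_scalerDl x :
  {morph (fun a => mquot_scale a x) : a b / a + b}.
Proof.
move=> a b; elim/(@quotW _ mquot): x => v.
by rewrite !pi_mquot_scale -pi_mquotD scalerDl.
Qed.

HB.instance Definition _ := GRing.Zmodule_isLmodule.Build R mquot
  mquot_scalerA mquot_scale1r mquot_scalerDr mquot_scalerDl.

End QuotientModule.

Section Ideals.
Variable R : comNzRingType.

Definition ideal := submodClosed R^o.

Definition iset (I : ideal) : set R := [set x : R | (x : R^o) \in I].

Definition is_ideal (J : set R) : Prop := @is_submodule R R^o J.

Definition noetherian : Prop :=
  forall J : set R, is_ideal J -> exists s : seq R^o, J = mspan s.

Definition is_maximal (J : set R) : Prop :=
  [/\ is_ideal J, J <> [set: R] &
      forall K, is_ideal K -> J `<=` K -> K = J \/ K = [set: R]].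

Definition is_prime (J : set R) : Prop :=
  [/\ is_ideal J, J <> [set: R] &
      forall x y, J (x * y) -> J x \/ J y].

Definition radical (J : set R) : set R := [set x | exists n : nat, J (x ^+ n)].

Definition is_primary (J : set R) : Prop :=
  [/\ is_ideal J, J <> [set: R] &
      forall x y, J (x * y) -> J x \/ radical J y].

Definition primary_to (p J : set R) : Prop := is_primary J /\ radical J = p.

Definition is_local (m : set R) : Prop :=
  is_maximal m /\ forall n, is_maximal n -> n = m.

Definition krull_dim : \bar int := chain_sup is_prime.

Definition regular_seq (s : seq R^o) : Prop :=
  (forall i x, (i < size s)%N ->
     mspan (take i s) (s`_i * x) -> mspan (take i s) x) /\
  mspan s <> [set: R].

Definition depth (m : set R) : \bar int :=
  supremum (-oo)%E
    [set z | exists s : seq R^o,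
       [/\ z = ((size s)%:Z)%:E, [set` s] `<=` m & regular_seq s]].

Definition cohen_macaulay_local (m : set R) : Prop :=
  [/\ noetherian, is_local m & depth m = krull_dim].

Definition is_domain : Prop := forall x y : R, x * y = 0 -> x = 0 \/ y = 0.

Definition is_dvr (n : set R) : Prop :=
  [/\ is_domain,
      forall J, is_ideal J -> exists a, J = range ( *%R a),
      is_local n & n <> [set 0]].

Definition ideal_mul (J K : set R) : set R :=
  [set z | exists s : seq (R * R),
     (forall p, p \in s -> J p.1 /\ K p.2) /\ z = \sum_(p <- s) p.1 * p.2].

Definition ideal_exp (K : set R) (n : nat) : set R :=
  iter n (ideal_mul K) [set: R].

Definition has_principal_reduction (K : set R) : Prop :=
  exists a, K a /\ exists n, ideal_exp K n.+1 = ( *%R a) @` ideal_exp K n.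

Definition principal_ideal (a : R) : {pred R^o} := [in range ( *%R a)].

Fact principal_ideal_closed a : submod_closed (principal_ideal a).
Proof.
split=> [|b x y]; first by apply/mem_set; exists 0; rewrite ?mulr0.
move=> /set_mem[x' _ <-] /set_mem[y' _ <-]; apply/mem_set.
by exists (b * x' + y') => //; rewrite mulrDr mulrCA.
Qed.
HB.instance Definition _ a := GRing.isSubmodClosed.Build R R^o
  (principal_ideal a) (principal_ideal_closed a).

Definition ideal_mod (I : ideal) : Type := {x : R^o | x \in I}.

End Ideals.
Arguments noetherian : clear implicits.
Arguments krull_dim : clear implicits.

HB.instance Definition _ (R : comNzRingType) (I : ideal R) :=
  SubChoice.on (ideal_mod I).
HB.instance Definition _ (R : comNzRingType) (I : ideal R) :=
  [SubChoice_isSubLmodule of ideal_mod I by <:].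

Section PartialTrace.
Variables (R : comNzRingType) (M : lmodType R).

Definition im_ideal (f : {linear M -> R^o}) : {pred R^o} := [in range f].

Fact im_ideal_closed f : submod_closed (im_ideal f).
Proof.
split=> [|b x y]; first by apply/mem_set; exists 0; rewrite ?linear0.
move=> /set_mem[x' _ <-] /set_mem[y' _ <-]; apply/mem_set.
by exists (b *: x' + y') => //; rewrite linearP.
Qed.
HB.instance Definition _ f := GRing.isSubmodClosed.Build R R^o
  (im_ideal f) (im_ideal_closed f).

Definition trace_colength : \bar int :=
  infimum (+oo)%E
    [set mlength (mquot (im_ideal f)) | f in [set: {linear M -> R^o}]].

Definition partial_trace_ideal (J : set R) : Prop :=
  exists f : {linear M -> R^o},
    J = range f /\ mlength (mquot (im_ideal f)) = trace_colength.

End PartialTrace.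
Arguments trace_colength {R} M.
Arguments partial_trace_ideal {R} M J.

Section TotalQuotientRing.
Variables (R Q : comNzRingType) (iota : {rmorphism R -> Q}).

(* [Q] is the localization of [R] at the set of its non-zerodivisors
   ([GRing.lreg]); this determines (Q, iota) up to a unique isomorphism. *)
Definition is_total_quotient_ring : Prop :=
  [/\ injective iota,
      forall b, GRing.lreg b -> exists c, iota b * c = 1 &
      forall q, exists a b, GRing.lreg b /\ q * iota b = iota a].

Definition colon (J : set R) : set Q :=
  [set alpha | forall x, J x -> range iota (alpha * iota x)].

Definition integral_closure : {pred Q} := [in [set z | integralOver iota z]].

Fact integral_closure_subring : subring_closed integral_closure.
Proof.
split=> [|x y /set_mem xI /set_mem yI|x y /set_mem xI /set_mem yI];
  apply/mem_set; [exact: integral1 | exact: integral_sub | exact: integral_mul].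
Qed.
HB.instance Definition _ := GRing.isSubringClosed.Build Q integral_closure
  integral_closure_subring.

Definition Rbar : Type := {x : Q | x \in integral_closure}.
HB.instance Definition _ := SubChoice.on Rbar.
HB.instance Definition _ := [SubChoice_isSubComNzRing of Rbar by <:].

Fact iota_integral (x : R) : iota x \in integral_closure.
Proof. by apply/mem_set; exact: integral_id. Qed.

Definition iotabar (x : R) : Rbar := exist _ (iota x) (iota_integral x).

(* Since the projection from [R] is surjective, phi is determined by its second
   property and it is automatically a ring morphism. *)
Definition same_residue_field (m : ideal R) (n : ideal Rbar) : Prop :=
  exists phi : mquot m -> mquot n,
    bijective phi /\
    forall x : R, phi (\pi_(mquot m) x) = \pi_(mquot n) (iotabar x).

Definition colengthbar (a : R) : \bar int :=
  mlength (mquot (principal_ideal (iotabar a))).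

(* The value does not depend on the fraction a / b that [xget] picks when
   [Rbar] is a discrete valuation ring. *)
Definition valuation (alpha : Q) : \bar int :=
  xget (+oo)%E
    [set z | exists a b, [/\ GRing.lreg b, alpha * iota b = iota a &
       z = (colengthbar a - colengthbar b)%E]].

End TotalQuotientRing.

(* Main.v *)
Require Import Defs.
From mathcomp Require Import all_boot all_order all_algebra.
From mathcomp Require Import mathcomp_extra boolp classical_sets functions.
From mathcomp Require Import constructive_ereal.
From HB Require Import structures.
From mathcomp Require Import zify ring.

(** Write T for the integral closure of R in Q, and l for length.  Everything
    rests on comparing l(R/J) with l(R/alpha J), for an ideal J containing a
    non-zerodivisor and alpha in R : J.

    The element alpha is integral exactly when alpha D <= D for some ideal D
    containing a non-zerodivisor, and D can then be taken inside J
    ([integral_stable], and [stable_integral] by Cayley-Hamilton).  All ideals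
    containing a non-zerodivisor have finite colength, because R has dimension
    one ([dim1_finite_colength]).  Multiplication by alpha maps J / D onto
    alpha J / alpha D, so

      l(R/D) <= l(R/alpha D) = l(R/alpha J) + l(alpha J/alpha D)
             <= l(R/alpha J) + l(J/D),

    that is, l(R/J) <= l(R/alpha J) ([integral_colength_le]).  If equality holds
    then alpha D = D, and the inverse of alpha, when it exists, is integral too
    ([integral_colength_eq]).

    (1) Every homomorphism from I to R is the multiplication by an element of
    R : I ([linear_idealE]).  So if R : I lies in T, the inclusion of I in R has
    an image of least colength, and I is a partial trace ideal of itself.
    Conversely let I be a partial trace ideal of M, and alpha = e / d in R : I
    with d, e in m.  If (a) is a principal reduction of (d, e), then d / a and
    e / a are integral ([principal_reduction_integral]).  The element
    beta = a / d is a combination of 1 and alpha, so it lies in R : I and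
    l(R/I) <= l(R/beta I) by minimality; since the inverse d / a of beta is
    integral, the opposite inequality also holds.  The equality case shows that
    beta is integral, and alpha = beta (e / a) is integral as well.

    (2) All partial trace ideals of I are multiples of I by units of Q, hence
    K = alpha J for a unit alpha of Q, and only l(R/alpha J) = l(R/J) is left to
    compare with v(alpha) = 0.  Since T is a discrete valuation ring, alpha or
    its inverse is in T, and the equality case above says that both are in T
    ([colen_smul_valuation]); the units of T are the elements of value zero
    ([valuation_eq0]). *)

Set Implicit Arguments.
Unset Strict Implicit.
Unset Printing Implicit Defensive.

Import Order.TTheory GRing.Theory Num.Theory.

Local Open Scope classical_set_scope.
Local Open Scope ring_scope.

(** * Suprema of sets of natural numbers in the extended integers *)

Lemma ex_max_nat (P : set nat) k :
  P !=set0 -> (forall n, P n -> (n <= k)%N) ->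
  exists m, P m /\ forall n, P n -> (n <= m)%N.
Proof.
move=> [i Pi] Pk.
have exP : exists n, `[< P n >] by exists i; apply/asboolP.
have ubP n : `[< P n >] -> (n <= k)%N by move/asboolP; exact: Pk.
case: (ex_maxnP exP ubP) => m /asboolP Pm maxm.
by exists m; split=> // n Pn; apply: maxm; apply/asboolP.
Qed.

Lemma ex_min_nat (P : set nat) :
  P !=set0 -> exists m, P m /\ forall n, P n -> (m <= n)%N.
Proof.
move=> [i Pi].
have exP : exists n, `[< P n >] by exists i; apply/asboolP.
case: (ex_minnP exP) => m /asboolP Pm minm.
by exists m; split=> // n Pn; apply: minm; apply/asboolP.
Qed.

Lemma lee_nat (m n : nat) :
  ((m%:Z)%:E <= (n%:Z)%:E :> \bar int)%E = (m <= n)%N.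
Proof. by rewrite lee_fin lez_nat. Qed.

(** The supremum of a set of natural numbers; it is -oo for the empty set. *)
Definition natsup (N : set nat) : \bar int :=
  supremum (-oo)%E [set z | exists n : nat, z = (n%:Z)%:E /\ N n].

Lemma natsup_isLub (N : set nat) :
  N !=set0 -> isLub [set z | exists n : nat, z = (n%:Z)%:E /\ N n] (natsup N).
Proof.
move=> N0; rewrite /natsup; set A := [set z | _].
suff [x xsup] : supremums A !=set0.
  rewrite /supremum; case: ifPn => [/eqP A0|_].
    have [n Nn] := N0; suff : A (n%:Z)%:E by rewrite A0.
    by exists n.
  by case: xgetP => [y _ []|/(_ x)//].
have [[k kub]|nub] := pselect (exists k, forall n, N n -> (n <= k)%N).
  have [m [Nm mmax]] := ex_max_nat N0 kub.
  exists (m%:Z)%:E; split; first by move=> _ [n [-> /mmax]]; rewrite lee_nat.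
  by move=> y; apply; exists m.
exists (+oo)%E; split; first by move=> y _; rewrite leey.
move=> [r| |] // ub.
  exfalso; apply: nub; exists `|r|%N => n Nn.
  have : A (n%:Z)%:E by exists n.
  by move/ub; rewrite lee_fin; lia.
have [n Nn] := N0; have : A (n%:Z)%:E by exists n.
by move/ub.
Qed.

Lemma natsup_ge (N : set nat) n : N n -> ((n%:Z)%:E <= natsup N)%E.
Proof.
move=> Nn; have /natsup_isLub[ub _] : N !=set0 by exists n.
by apply: ub; exists n.
Qed.

Lemma natsup_max (N : set nat) n :
  N n -> (forall k, N k -> (k <= n)%N) -> natsup N = (n%:Z)%:E.
Proof.
move=> Nn maxn; apply/le_anti; rewrite natsup_ge// andbT.
have /natsup_isLub[_] : N !=set0 by exists n.
by apply=> _ [k [-> /maxn]]; rewrite lee_nat.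
Qed.

(** The possible values of a length: a natural number or +oo. *)
Definition natinf (z : \bar int) : Prop :=
  z = (+oo)%E \/ exists n : nat, z = (n%:Z)%:E.

Lemma natsup_natinf (N : set nat) : N !=set0 -> natinf (natsup N).
Proof.
move=> N0; have [[k kub]|nub] := pselect (exists k, forall n, N n -> (n <= k)%N).
  by right; have [m [Nm mmax]] := ex_max_nat N0 kub; exists m; exact: natsup_max.
left; have [ub lub] := natsup_isLub N0; case E : (natsup N) => [r| |] //.
  exfalso; apply: nub; exists `|r|%N => n /natsup_ge.
  by rewrite E lee_fin; lia.
by have [n /natsup_ge] := N0; rewrite E.
Qed.

(** A nonempty set of lengths attains its infimum. *)
Lemma infimum_isGlb (A : set (\bar int)) :
  A `<=` natinf -> A !=set0 ->
  A (infimum +oo%E A) /\ lbound A (infimum +oo%E A).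
Proof.
move=> Anat [z Az].
suff [x [Ax xlb]] : exists x, A x /\ lbound A x.
  suff -> : infimum +oo%E A = x by [].
  rewrite /infimum; case: ifPn => [/eqP A0|_]; first by move: Az; rewrite A0.
  have xinf : infimums A x by split=> // y; apply.
  exact: (xget_subset1 _ xinf (@is_subset1_infimums _ _ A)).
have [[n An]|nA] := pselect (exists n : nat, A (n%:Z)%:E).
  have [m [Am mmin]] := @ex_min_nat [set k | A ((k : nat)%:Z)%:E] (ex_intro _ n An).
  exists (m%:Z)%:E; split=> // y Ay; have [->|[k yk]] := Anat _ Ay.
    by rewrite leey.
  by rewrite yk lee_nat; apply: mmin; rewrite /= -yk.
have Apoo y : A y -> y = (+oo)%E.
  by move=> Ay; have [//|[k yk]] := Anat _ Ay; case: nA; exists k; rewrite -yk.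
by exists z; split=> // y Ay; rewrite (Apoo _ Ay) leey.
Qed.

(** * Chains of submodules and lengths *)

Section Chains.
Variables (R : comNzRingType) (V : lmodType R).
Implicit Types (A B C X Y : set V).

Lemma submoduleP X :
  is_submodule X <-> X 0 /\ forall a x y, X x -> X y -> X (a *: x + y).
Proof.
split=> [[X0 Xl]|[X0 Xl]].
  split=> [|a x y Xx Xy]; first exact: set_mem.
  by apply: set_mem; apply: Xl; exact: mem_set.
split=> [|a x y /set_mem Xx /set_mem Xy]; apply: mem_set => //; exact: Xl.
Qed.

Lemma submoduleD X x y : is_submodule X -> X x -> X y -> X (x + y).
Proof. by move=> /submoduleP[_ Xl] Xx Xy; rewrite -[x]scale1r; exact: Xl. Qed.

Lemma submoduleZ X a x : is_submodule X -> X x -> X (a *: x).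
Proof. by move=> /submoduleP[X0 Xl] Xx; rewrite -[_ *: x]addr0; exact: Xl. Qed.

Lemma submoduleB X x y : is_submodule X -> X x -> X y -> X (x - y).
Proof.
by move=> /submoduleP[_ Xl] Xx Xy; rewrite addrC -scaleN1r; exact: Xl.
Qed.

Lemma submodule_sum X (I : Type) (r : seq I) (P : pred I) (F : I -> V) :
  is_submodule X -> (forall i, P i -> X (F i)) -> X (\sum_(i <- r | P i) F i).
Proof.
move=> sX XF; elim/big_ind : _ => // [|x y]; last exact: submoduleD.
by have /submoduleP[] := sX.
Qed.

Lemma submoduleT : is_submodule [set: V].
Proof. by apply/submoduleP. Qed.

Lemma submodule0 : is_submodule [set 0 : V].
Proof. by apply/submoduleP; split=> // a x y -> ->; rewrite scaler0 addr0. Qed.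

Lemma submoduleI X Y : is_submodule X -> is_submodule Y ->
  is_submodule (X `&` Y).
Proof.
move=> /submoduleP[X0 Xl] /submoduleP[Y0 Yl]; apply/submoduleP; split=> //.
by move=> a x y [Xx Yx] [Xy Yy]; split; [exact: Xl|exact: Yl].
Qed.

(** The sum of two submodules. *)
Definition msum X Y : set V := [set z | exists x y, [/\ X x, Y y & z = x + y]].

Lemma submodule_msum X Y : is_submodule X -> is_submodule Y ->
  is_submodule (msum X Y).
Proof.
move=> /submoduleP[X0 Xl] /submoduleP[Y0 Yl]; apply/submoduleP; split.
  by exists 0, 0; rewrite addr0.
move=> a _ _ [x [y [Xx Yy ->]]] [x' [y' [Xx' Yy' ->]]].
exists (a *: x + x'), (a *: y + y'); split; [exact: Xl|exact: Yl|].
by rewrite scalerDr addrACA.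
Qed.

(** [chain A B n]: there is a strictly increasing chain of n + 1 submodules
    lying between A and B. *)
Definition chain A B (n : nat) : Prop :=
  exists c : nat -> set V,
    (forall i, (i <= n)%N ->
       [/\ is_submodule (c i), A `<=` c i & c i `<=` B]) /\
    (forall i, (i < n)%N -> c i `<` c i.+1).

Lemma chainW A A' B B' n n' :
  A' `<=` A -> B `<=` B' -> (n' <= n)%N -> chain A B n -> chain A' B' n'.
Proof.
move=> sA sB nn [c [cs clt]]; exists c; split=> i lei; last first.
  exact/clt/(leq_trans lei).
have [si Ai Bi] := cs i (leq_trans lei nn).
by split=> //; [exact: subset_trans Ai|exact: subset_trans sB].
Qed.

Lemma chain0 A B : is_submodule A -> A `<=` B -> chain A B 0.
Proof. by move=> sA AB; exists (fun=> A); split=> // i _; split. Qed.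

Lemma chain1 A B : is_submodule A -> is_submodule B -> A `<` B -> chain A B 1.
Proof.
move=> sA sB AB; exists (fun i => if i == 0%N then A else B).
split=> [i _|[|i]//].
by case: ifP => _; split=> //; exact: properW.
Qed.

Lemma chain_cat A B C n1 n2 :
  A `<=` B -> B `<=` C -> chain A B n1 -> chain B C n2 -> chain A C (n1 + n2).
Proof.
move=> AB BC [c [cs clt]] [d [ds dlt]].
exists (fun i => if (i <= n1)%N then c i else d (i - n1)%N); split=> i lei.
  case: ifPn => i1.
    by have [? ? ?] := cs i i1; split=> //; exact: subset_trans BC.
  have [|? ? ?] := ds (i - n1)%N; first by lia.
  by split=> //; exact: subset_trans AB _.
have [i1|i1] := leqP i.+1 n1; first by rewrite ltnW//; exact: clt.
case: ifPn => i2.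
  have -> : i = n1 by lia.
  rewrite subSnn; have [_ _ cB] := cs _ (leqnn n1).
  have [_ Bd _] := ds _ (leq0n n2).
  have [|s1 s2] := dlt 0%N; first by lia.
  split; first exact: subset_trans cB (subset_trans Bd s1).
  by apply: contra_not s2 => s3; exact: subset_trans s3 (subset_trans cB Bd).
by rewrite subSn; [apply: dlt|]; lia.
Qed.

(** Subadditivity of length along a submodule B: by the modular law, each
    strict step X < Y of a chain stays strict after intersecting with B or
    after adding B. *)
Lemma chain_split A B C n :
  is_submodule A -> is_submodule B -> A `<=` B -> B `<=` C -> is_submodule C ->
  chain A C n ->
  exists n1 n2, [/\ (n <= n1 + n2)%N, chain A B n1 & chain B C n2].
Proof.
move=> sA sB AB BC sC [c [cs clt]].
suff main k : (k <= n)%N -> exists n1 n2, [/\ (k <= n1 + n2)%N,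
    chain A (c k `&` B) n1 & chain B (msum (c k) B) n2].
  have [n1 [n2 [le_n c1 c2]]] := main n (leqnn n); exists n1, n2; split=> //.
    by apply: chainW c1 => //; exact: subIsetr.
  apply: chainW c2 => // _ [x [y [cx /BC Cy ->]]].
  have [_ _ cC] := cs n (leqnn n).
  by apply: submoduleD => //; exact: cC.
elim: k => [_|k IHk lek].
  exists 0%N, 0%N; have [s0 A0 _] := cs 0%N isT; split=> //.
    apply: chain0 => // x Ax; split; [exact: A0|exact: AB].
  apply: chain0 => // x Bx; exists 0, x; rewrite add0r; split=> //.
  by have /submoduleP[] := s0.
have [n1 [n2 [le_k c1 c2]]] := IHk (ltnW lek).
have [sk Ak Ck] := cs k (ltnW lek); have [sk1 Ak1 Ck1] := cs k.+1 lek.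
have [sub nsub] := clt k lek.
have subI : c k `&` B `<=` c k.+1 `&` B by exact: setSI.
have subD : msum (c k) B `<=` msum (c k.+1) B.
  by move=> _ [x [y [cx By ->]]]; exists x, y; split=> //; exact: sub.
have AI : A `<=` c k `&` B by move=> x Ax; split; [exact: Ak|exact: AB].
have BD : B `<=` msum (c k) B.
  move=> x Bx; exists 0, x; rewrite add0r; split=> //.
  by have /submoduleP[] := sk.
(* If the traces on B agree, then the sums with B differ, by the modular law. *)
have [eqI|neqI] := pselect (c k.+1 `&` B `<=` c k `&` B).
- exists n1, n2.+1; split; first by lia.
    exact: chainW c1.
  rewrite -(addn1 n2); apply: (chain_cat _ _ c2 (chain1 _ _ _)) => //.
  + exact: submodule_msum.
  + exact: submodule_msum.
  + split=> // eqD; apply: nsub => x cx.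
    have [] := eqD x.
      by exists x, 0; rewrite addr0; split=> //; have /submoduleP[] := sB.
    move=> u [v [cu Bv xuv]].
    have [] := eqI v; last by move=> cv _; rewrite xuv; exact: submoduleD.
    split=> //; have -> : v = x - u by rewrite xuv addrAC subrr add0r.
    by apply: submoduleB => //; exact: sub.
- exists n1.+1, n2; split; first by lia.
    rewrite -(addn1 n1); apply: (chain_cat _ _ c1 (chain1 _ _ _)) => //;
      exact: submoduleI.
  exact: chainW c2.
Qed.

(** [haslen A B n]: B / A has length n. *)
Definition haslen A B n : Prop :=
  chain A B n /\ forall k, chain A B k -> (k <= n)%N.

(** B / A has finite length. *)
Definition finlen A B : Prop := exists n, forall k, chain A B k -> (k <= n)%N.

Lemma finlenP A B : is_submodule A -> A `<=` B -> finlen A B ->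
  exists n, haslen A B n.
Proof.
move=> sA AB [n bn].
have [|m [? ?]] := @ex_max_nat [set k | chain A B k] n _ bn; last by exists m.
by exists 0%N; exact: chain0.
Qed.

Lemma haslen_add A B C n1 n2 :
  is_submodule A -> is_submodule B -> A `<=` B -> B `<=` C -> is_submodule C ->
  haslen A B n1 -> haslen B C n2 -> haslen A C (n1 + n2).
Proof.
move=> sA sB AB BC sC [c1 m1] [c2 m2]; split.
  exact: (chain_cat AB BC c1 c2).
move=> k /(chain_split sA sB AB BC sC)[k1 [k2 [le_k /m1 d1 /m2 d2]]]; lia.
Qed.

Lemma finlen_trans A B C :
  is_submodule A -> is_submodule B -> A `<=` B -> B `<=` C -> is_submodule C ->
  finlen A B -> finlen B C -> finlen A C.
Proof.
move=> sA sB AB BC sC [n1 m1] [n2 m2]; exists (n1 + n2)%N.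
move=> k /(chain_split sA sB AB BC sC)[k1 [k2 [le_k /m1 d1 /m2 d2]]]; lia.
Qed.

Lemma finlenW A A' B B' :
  A `<=` A' -> B' `<=` B -> finlen A B -> finlen A' B'.
Proof.
by move=> sA sB [n bn]; exists n => k ck; apply: bn; exact: chainW ck.
Qed.

End Chains.

(** Transport of chains along a monotone map of submodules that is injective
    on the interval from A to B. *)
Lemma chain_transport (R S : comNzRingType) (V : lmodType R) (W : lmodType S)
    (A B : set V) (A' B' : set W) (phi : set V -> set W) n :
  (forall X, is_submodule X -> A `<=` X -> X `<=` B ->
     [/\ is_submodule (phi X), A' `<=` phi X & phi X `<=` B']) ->
  (forall X Y, X `<=` Y -> phi X `<=` phi Y) ->
  (forall X Y, is_submodule X -> is_submodule Y -> A `<=` X -> A `<=` Y ->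
     X `<=` B -> Y `<=` B -> phi Y `<=` phi X -> Y `<=` X) ->
  chain A B n -> chain A' B' n.
Proof.
move=> phiS phiM phiI [c [cs clt]]; exists (phi \o c); split=> i lei.
  by have [? ? ?] := cs i lei; exact: phiS.
have [sub nsub] := clt i lei; split; first exact: phiM.
have [? ? ?] := cs i (ltnW lei); have [? ? ?] := cs i.+1 lei.
by apply: contra_not nsub; exact: phiI.
Qed.

Section QuotientLength.
Variables (R : comNzRingType) (V : lmodType R) (N : submodClosed V).
Import Quotient.
Local Open Scope quotient_scope.

(* N as a set. *)
Let N' : set V := [set v | v \in N].

Lemma pi_mquot_eq u v : (\pi_(mquot N) u = \pi_(mquot N) v) <-> N' (u - v).
Proof.
rewrite /N' /= -[u - v \in N]/(u - v \in zmod_of N).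
by rewrite (@idealrBE _ (zmod_of N)); split=> [->|/eqP].
Qed.

Lemma pi_mquotZ a v : \pi_(mquot N) (a *: v) = a *: \pi_(mquot N) v.
Proof. by rewrite -[RHS]/(mquot_scale a _) pi_mquot_scale. Qed.

Lemma pi_mquot0 : \pi_(mquot N) 0 = 0.
Proof. by apply: (addrI (\pi_(mquot N) 0)); rewrite -pi_mquotD !addr0. Qed.

Lemma submodule_submodClosed : is_submodule N'.
Proof.
apply/submoduleP; split; first exact: rpred0.
by move=> a x y Nx Ny; apply: rpredD => //; apply: rpredZ.
Qed.

Lemma chain_mquot n :
  chain N' [set: V] n <-> chain set0 [set: mquot N] n.
Proof.
have reprE v : N' (repr (\pi_(mquot N) v) - v).
  by apply/pi_mquot_eq; rewrite reprK.
split.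
- pose phi (X : set V) : set (mquot N) := [set q | X (repr q)].
  have phiE X v : is_submodule X -> N' `<=` X ->
      phi X (\pi_(mquot N) v) <-> X v.
    move=> sX NX; have Xd := NX _ (reprE v); split=> Xv.
      have -> : v = repr (\pi_(mquot N) v) - (repr (\pi_(mquot N) v) - v).
        by rewrite opprB addrC subrK.
      exact: submoduleB.
    by rewrite /phi /= -(subrK v (repr _)); exact: submoduleD.
  apply: (@chain_transport _ _ _ _ _ _ _ _ phi)
    => [X sX NX _|X Y XY q|X Y sX sY NX NY _ _ YX v Yv].
  + split=> //; apply/submoduleP; split.
      by rewrite -pi_mquot0; apply/phiE => //; have /submoduleP[] := sX.
    move=> a x y Xx Xy; rewrite -(reprK x) -(reprK y) -pi_mquotZ -pi_mquotD.
    by apply/phiE => //; apply: submoduleD => //; exact: submoduleZ.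
  + exact: XY.
  + by apply/(phiE X) => //; apply: YX; apply/phiE.
- pose psi (Y : set (mquot N)) : set V := [set v | Y (\pi_(mquot N) v)].
  apply: (@chain_transport _ _ _ _ _ _ _ _ psi)
    => [Y sY _ _|X Y XY v|X Y sX sY _ _ _ _ YX q Yq].
  + split=> //; last first.
      move=> v Nv; have /submoduleP[Y0 _] := sY.
      rewrite /psi /= (_ : \pi_(mquot N) v = 0) //.
      by rewrite -pi_mquot0; apply/pi_mquot_eq; rewrite subr0.
    apply/submoduleP; split.
      by rewrite /psi /= pi_mquot0; have /submoduleP[] := sY.
    move=> a x y Yx Yy; rewrite /psi /= pi_mquotD pi_mquotZ.
    by apply: submoduleD => //; exact: submoduleZ.
  + exact: XY.
  + by rewrite -(reprK q); apply: YX; rewrite /psi /= reprK.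
Qed.

(** The length of V / N counts the submodules between N and V. *)
Lemma mlength_mquot : mlength (mquot N) = natsup (chain N' [set: V]).
Proof.
rewrite /mlength /chain_sup /natsup; congr supremum; apply/seteqP.
split=> z /= [n [-> cn]]; exists n; split=> //.
  apply/chain_mquot; have [c [cs clt]] := cn.
  by exists c; split=> // i /cs; split.
by have /chain_mquot[c [cs clt]] := cn; exists c; split=> // i /cs[].
Qed.

End QuotientLength.

(** * Noetherian rings *)

Section Ideals.
Variable R : comNzRingType.
Implicit Types (J K P : set R) (x y a b : R).

Lemma idealP J :
  is_ideal J <-> J 0 /\ forall a x y, J x -> J y -> J (a * x + y).
Proof. exact: (@submoduleP R R^o J). Qed.

Lemma ideal0 J : is_ideal J -> J 0.
Proof. by case/idealP. Qed.

Lemma idealD J x y : is_ideal J -> J x -> J y -> J (x + y).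
Proof. exact: (@submoduleD R R^o J). Qed.

Lemma idealB J x y : is_ideal J -> J x -> J y -> J (x - y).
Proof. exact: (@submoduleB R R^o J). Qed.

Lemma idealM J a x : is_ideal J -> J x -> J (a * x).
Proof. exact: (@submoduleZ R R^o J). Qed.

Lemma idealT : is_ideal [set: R].
Proof. exact: (@submoduleT R R^o). Qed.

Lemma ideal_1 J : is_ideal J -> J 1 -> J = [set: R].
Proof.
by move=> iJ J1; apply/seteqP; split=> // x _; rewrite -[x]mulr1; exact: idealM.
Qed.

Lemma ideal_iset (I : ideal R) : is_ideal (iset I).
Proof. exact: (@submodule_submodClosed R R^o I). Qed.

Lemma ideal_range x : is_ideal (range ( *%R x)).
Proof.
apply/idealP; split; first by exists 0; rewrite ?mulr0.
move=> a _ _ [u _ <-] [v _ <-]; exists (a * u + v) => //.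
by rewrite mulrDr mulrCA.
Qed.

(** The ideal generated by J and x. *)
Definition adjoin J x : set R := [set z | exists j r, J j /\ z = j + r * x].

Lemma ideal_adjoin J x : is_ideal J -> is_ideal (adjoin J x).
Proof.
move=> iJ; apply/idealP; split.
  by exists 0, 0; rewrite mul0r addr0; split=> //; exact: ideal0.
move=> a _ _ [j [r [Jj ->]]] [k [s [Jk ->]]].
exists (a * j + k), (a * r + s); split; last by ring.
by apply: idealD => //; exact: idealM.
Qed.

Lemma sub_adjoin J x : J `<=` adjoin J x.
Proof. by move=> j Jj; exists j, 0; rewrite mul0r addr0. Qed.

Lemma mem_adjoin J x : is_ideal J -> adjoin J x x.
Proof.
by move=> iJ; exists 0, 1; rewrite mul1r add0r; split=> //; exact: ideal0.
Qed.

Lemma adjoin_proper J x : is_ideal J -> ~ J x -> J `<` adjoin J x.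
Proof.
move=> iJ Jx; split; first exact: sub_adjoin.
by apply: contra_not Jx; apply; exact: mem_adjoin.
Qed.

Lemma mspan_sub J (s : seq R^o) :
  is_ideal J -> (forall x, x \in s -> J x) -> mspan s `<=` J.
Proof.
move=> iJ sJ _ [c ->]; apply: (@submodule_sum R R^o) => // i _.
by apply: idealM => //; apply: sJ; exact: mem_nth.
Qed.

Lemma mem_mspan (s : seq R^o) i : (i < size s)%N -> mspan s s`_i.
Proof.
move=> lti; exists (fun j : 'I_(size s) => if val j == i then 1 else 0).
rewrite (bigD1 (Ordinal lti)) //= eqxx scale1r big1 ?addr0// => j.
by rewrite -val_eqE /= => /negPf ->; rewrite scale0r.
Qed.

(** Noetherian induction on ideals, ordered by reverse inclusion. *)
Lemma noetherian_ind (P : set R -> Prop) :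
  noetherian R ->
  (forall J, is_ideal J -> (forall K, is_ideal K -> J `<` K -> P K) -> P J) ->
  forall J, is_ideal J -> P J.
Proof.
move=> noeth step J0 iJ0; apply: contrapT => nP0.
pose T := {J : set R | is_ideal J /\ ~ P J}.
have next (t : T) : exists t' : T, projT1 t `<` projT1 t'.
  case: t => J [iJ nPJ] /=; apply: contrapT => nex; apply: nPJ.
  apply: step => // K iK JK; apply: contrapT => nPK; apply: nex.
  by exists (exist _ K (conj iK nPK)).
have [f fP] := choice next.
pose c n := projT1 (iter n f (exist _ J0 (conj iJ0 nP0) : T)).
have ic n : is_ideal (c n) by rewrite /c; case: (iter _ _ _) => ? [].
have c_lt n : c n `<` c n.+1 by exact: fP.
have c_mono n k : (n <= k)%N -> c n `<=` c k.
  move=> /subnK <-; elim: (k - n)%N => // d IHd; apply: subset_trans IHd _.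
  by rewrite addSn; exact: properW.
have [|s Us] := noeth (\bigcup_n c n).
  apply/idealP; split; first by exists 0%N => //; exact: ideal0.
  move=> a x y [n _ cx] [k _ cy]; exists (maxn n k) => //.
  apply: idealD => //; last by apply: c_mono cy; exact: leq_maxr.
  by apply: idealM => //; apply: c_mono cx; exact: leq_maxl.
(* The union of the chain is generated by s, which lies in a single term. *)
have [N sN] : exists N, forall x, x \in s -> c N x.
  have : forall x, x \in s -> (\bigcup_n c n) x.
    move=> x xs; rewrite Us -(nth_index 0 xs).
    by apply: mem_mspan; rewrite index_mem.
  elim: {Us}s => [_|x s IHs xs]; first by exists 0%N.
  have [|N cN] := IHs; first by move=> y ys; apply: xs; rewrite inE ys orbT.
  have [|n _ cn] := xs x; first by rewrite inE eqxx.
  exists (maxn n N) => y; rewrite inE => /orP[/eqP->|/cN].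
    by apply: c_mono cn; exact: leq_maxl.
  by apply: c_mono; exact: leq_maxr.
have [_] := c_lt N; apply => x cx; apply: (mspan_sub (ic N) sN).
by rewrite -Us; exists N.+1.
Qed.

Lemma ex_maximal J : noetherian R -> is_ideal J -> J <> [set: R] ->
  exists M, is_maximal M /\ J `<=` M.
Proof.
move=> noeth; move: J; apply: noetherian_ind => // J iJ IH JT.
have [maxJ|nmax] := pselect (is_maximal J); first by exists J; split.
have [K [iK JK KJ KT]] : exists K,
    [/\ is_ideal K, J `<=` K, K <> J & K <> [set: R]].
  apply: contrapT => nex; apply: nmax; split=> // K iK JK.
  apply: contrapT => /not_orP[KJ KT]; apply: nex; exists K; split=> //.
have [|M [maxM KM]] := IH K iK _ KT.
  by split=> // KsJ; apply: KJ; apply/seteqP.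
by exists M; split=> //; exact: subset_trans KM.
Qed.

Lemma not_prime J : is_ideal J -> J <> [set: R] -> ~ is_prime J ->
  exists x y, [/\ J (x * y), ~ J x & ~ J y].
Proof.
move=> iJ JT npJ; apply: contrapT => nex; apply: npJ; split=> // x y Jxy.
by apply: contrapT => /not_orP[Jx Jy]; apply: nex; exists x, y.
Qed.

(** Krull's lemma: an ideal avoiding a multiplicative set A is contained in a
    prime ideal avoiding A. *)
Lemma ex_prime_avoiding J (A : set R) : noetherian R -> is_ideal J ->
  A 1 -> (forall x y, A x -> A y -> A (x * y)) -> (forall x, J x -> ~ A x) ->
  exists P, [/\ is_prime P, J `<=` P & forall x, P x -> ~ A x].
Proof.
move=> noeth + A1 AM; move: J; apply: noetherian_ind => // J iJ IH JA.
have [pJ|npJ] := pselect (is_prime J); first by exists J; split.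
have JT : J <> [set: R] by move=> JT; apply: (JA 1) => //; rewrite JT.
have [x [y [Jxy Jx Jy]]] := not_prime iJ JT npJ.
have try z : ~ J z ->
    (exists P, [/\ is_prime P, J `<=` P & forall x, P x -> ~ A x])
    \/ exists2 a, adjoin J z a & A a.
  move=> Jz; have [|nex] := pselect (exists2 a, adjoin J z a & A a).
    by right.
  left; have [//| |x' x'A Ax'|P [pP JP PA]] := IH (adjoin J z).
  - exact: ideal_adjoin.
  - exact: adjoin_proper.
  - by apply: nex; exists x'.
  - by exists P; split=> //; apply: subset_trans JP; exact: sub_adjoin.
have [//|[_ [j [r [Jj ->]]] A1']] := try x Jx.
have [//|[_ [k [s [Jk ->]]] A2']] := try y Jy.
case: (JA _ _ (AM _ _ A1' A2')).
have -> : (j + r * x) * (k + s * y) =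
    (k + s * y) * j + (r * x * k + (r * s) * (x * y)) by ring.
by apply: idealD => //; [|apply: idealD => //]; exact: idealM.
Qed.

Lemma maximal_prime P : is_maximal P -> is_prime P.
Proof.
move=> [iP PT maxP]; split=> // x y Pxy.
have [Px|nPx] := pselect (P x); [by left|right].
have [PP|PT'] := maxP _ (ideal_adjoin x iP) (@sub_adjoin P x).
  by case: nPx; rewrite -PP; exact: mem_adjoin.
have [j [r [Pj one]]] : adjoin P x 1 by rewrite PT'.
have -> : y = y * j + r * (x * y).
  by rewrite -[LHS]mulr1 one; ring.
by apply: idealD => //; exact: idealM.
Qed.

Lemma maximal_finlen P : is_maximal P -> @finlen R R^o P [set: R].
Proof.
move=> [iP PT maxP]; exists 1%N => -[|[|k]] // [c [cs clt]]; exfalso.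
have [i0 P0 _] := cs 0%N isT; have [i1 P1 _] := cs 1%N isT.
have [s01 ns01] := clt 0%N isT; have [_ ns12] := clt 1%N isT.
have [c1|c1] := maxP _ i1 P1; first by apply: ns01; rewrite c1.
by apply: ns12; rewrite c1.
Qed.

(** If every prime ideal containing b is maximal, then every ideal containing b
    has finite colength: an ideal maximal among those of infinite colength is
    prime.  Indeed, if x * y is in J with x and y outside J, then J + (x) and
    (J : x) are strictly larger than J, and (J + (x)) / J is isomorphic to
    R / (J : x). *)
Lemma finite_colength b : noetherian R ->
  (forall P, is_prime P -> P b -> is_maximal P) ->
  forall J, is_ideal J -> J b -> @finlen R R^o J [set: R].
Proof.
move=> noeth bmax; apply: noetherian_ind => // J iJ IH Jb.
have [JT|JT] := pselect (J = [set: R]).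
  exists 0%N => -[|k] // [c [cs clt]]; exfalso.
  have [] := clt 0%N isT; have [_ J0 _] := cs 0%N isT.
  by move=> _; apply => x _; apply: J0; rewrite JT.
have [/bmax/(_ Jb)|npJ] := pselect (is_prime J); first exact: maximal_finlen.
have [x [y [Jxy Jx Jy]]] := not_prime iJ JT npJ.
(* C is the colon ideal (J : x). *)
pose C : set R := [set r | J (r * x)].
have iC : is_ideal C.
  apply/idealP; split; first by rewrite /C /= mul0r; exact: ideal0.
  move=> a u v Cu Cv; rewrite /C /= mulrDl -mulrA.
  by apply: idealD => //; exact: idealM.
have JC : J `<=` C by move=> r Jr; rewrite /C /= mulrC; exact: idealM.
apply: (@finlen_trans R R^o J (adjoin J x) [set: R]) => //.
- exact: ideal_adjoin.
- exact: sub_adjoin.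
- exact: idealT.
- have [|n bn] := IH C iC _ (JC _ Jb).
    by split=> // /(_ y); rewrite /C /= mulrC => /(_ Jxy).
  exists n => k ck; apply: bn; move: ck.
  pose phi X : set R := [set r | X (r * x)].
  apply: (@chain_transport _ _ R^o R^o _ _ _ _ phi) =>
      [X sX JX _|X Y XY r|X Y sX sY JX JY XA YA YX z Yz].
  + split=> // [|r Cr]; last exact: JX.
    apply/idealP; split; first by rewrite /phi /= mul0r; exact: (@ideal0 X).
    move=> a u v Xu Xv; rewrite /phi /= mulrDl -mulrA.
    by apply: (@idealD X) => //; exact: (@idealM X).
  + exact: XY.
  + have [j [r [Jj zE]]] := YA _ Yz.
    rewrite zE; apply: (@idealD X) => //; first exact: JX.
    apply: YX; rewrite /phi /= (_ : r * x = z - j).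
      by apply: (@idealB Y) => //; exact: JY.
    by rewrite zE addrAC subrr add0r.
- apply: IH; [exact: ideal_adjoin|exact: adjoin_proper|exact: sub_adjoin].
Qed.

(** * Local rings *)

Lemma local_sub (m J : set R) : noetherian R -> is_local m -> is_ideal J ->
  J <> [set: R] -> J `<=` m.
Proof. by move=> noeth [_ mu] iJ /(ex_maximal noeth iJ)[M [/mu ->]]. Qed.

Lemma local_unit (m : set R) x : noetherian R -> is_local m -> ~ m x ->
  exists y, x * y = 1.
Proof.
move=> noeth locm mx; apply: contrapT => nex; apply: mx.
apply: (local_sub noeth locm (ideal_range x)); last by exists 1; rewrite ?mulr1.
move=> rT; have : range ( *%R x) 1 by rewrite rT.
by move=> [y _ xy]; apply: nex; exists y.
Qed.

(** An ideal of finite colength contains a power of each element of m: the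
    chain of the J + (x ^ i) is stationary, and 1 - r x is invertible. *)
Lemma finlen_pow (m J : set R) x : noetherian R -> is_local m -> is_ideal J ->
  @finlen R R^o J [set: R] -> m x -> exists i, J (x ^+ i).
Proof.
move=> noeth locm iJ [n bn] mx; apply: contrapT => nex.
have im : is_ideal m by have [[]] := locm.
suff : @chain R R^o J [set: R] n.+1 by move/bn; rewrite ltnn.
exists (fun i => adjoin J (x ^+ (n.+1 - i))); split=> i lei.
  by split=> //; [exact: ideal_adjoin|exact: sub_adjoin].
have -> : (n.+1 - i)%N = (n.+1 - i.+1).+1 by lia.
set k := (n.+1 - i.+1)%N; split.
  move=> _ [j [r [Jj ->]]]; exists j, (r * x); split=> //.
  by rewrite exprS mulrA.
move=> /(_ (x ^+ k) (mem_adjoin _ iJ))[j [r [Jj xk]]].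
have [|y xy] := @local_unit m (1 - r * x) noeth locm.
  move=> m1; have [[_ mT _] _] := locm; apply: mT; apply: ideal_1 => //.
  by rewrite -(subrK (r * x) 1); apply: idealD => //; exact: idealM.
apply: nex; exists k.
rewrite -[x ^+ k]mulr1 -xy (_ : _ * _ = y * (x ^+ k - r * x ^+ k.+1)).
  by rewrite {1}xk addrK; exact: idealM.
by rewrite exprS; ring.
Qed.

End Ideals.

(** * Cohen-Macaulay local rings of dimension one *)

Section CohenMacaulay.
Variable R : comNzRingType.
Implicit Types (m J P : set R) (b : R).

(** The maximal ideal contains a non-zerodivisor, because the depth is 1. *)
Lemma cohen_macaulay_nzd m : cohen_macaulay_local m -> krull_dim R = 1%:E%E ->
  exists2 b, m b & GRing.lreg b.
Proof.
move=> [noeth locm depthE] dim1; rewrite dim1 in depthE.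
suff [s [s0 sm [reg _]]] : exists s : seq R^o,
    [/\ (0 < size s)%N, [set` s] `<=` m & regular_seq s].
  have lt0 : (0 < size s)%N by [].
  exists s`_0; first by apply: sm; exact: mem_nth.
  move=> x y /eqP; rewrite -subr_eq0 -mulrBr => /eqP sxy.
  apply/eqP; rewrite -subr_eq0; apply/eqP.
  have : mspan (take 0 s) (x - y); last first.
    by rewrite take0 => -[c ->]; rewrite big_ord0.
  by apply: reg lt0 _; rewrite sxy take0; exists (fun=> 0); rewrite big_ord0.
apply: contrapT => nex.
pose D : set nat := [set k | exists s : seq R^o,
  [/\ k = size s, [set` s] `<=` m & regular_seq s]].
have depthD : depth m = natsup D.
  congr supremum; apply/seteqP; split=> z /=.
    by move=> [s [-> ? ?]]; exists (size s); split=> //; exists s.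
  by move=> [_ [-> [s [-> ? ?]]]]; exists s.
have D0 k : D k -> (k <= 0)%N.
  move=> [s [-> ? ?]]; rewrite leqNgt; apply/negP => ?; apply: nex.
  by exists s.
have [[k Dk]|nD] := pselect (exists k, D k).
  have k0 : k = 0%N by have := D0 _ Dk; lia.
  move: depthE; rewrite depthD (@natsup_max _ 0%N) //; by rewrite -k0.
have DE : D = set0 by rewrite -subset0 => k Dk; apply: nD; exists k.
move: depthE; rewrite depthD DE /natsup (_ : [set z | _] = set0) ?supremum0//.
by rewrite -subset0 => z [? []].
Qed.

(** In dimension one a prime ideal P containing a non-zerodivisor b is maximal:
    an ideal maximal among those avoiding the products b ^ i * s, with s
    outside P, is a prime ideal strictly below P. *)
Lemma dim1_prime_maximal m b P : noetherian R -> is_local m ->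
  krull_dim R = 1%:E%E -> GRing.lreg b -> is_prime P -> P b -> is_maximal P.
Proof.
move=> noeth locm dim1 bnzd primeP Pb; have [iP PT PM] := primeP.
have Pm := local_sub noeth locm iP PT.
have [mP|mP] := pselect (m `<=` P).
  by rewrite (_ : P = m); [case: locm|apply/seteqP].
exfalso.
pose A : set R := [set a | exists i s, ~ P s /\ a = b ^+ i * s].
have P1 : ~ P 1 by move=> /(ideal_1 iP).
have [| | | |P0 [prP0 _ P0A]] := @ex_prime_avoiding R [set 0] A noeth.
- exact: (@submodule0 R R^o).
- by exists 0%N, 1; rewrite mulr1.
- move=> _ _ [i [s [Ps ->]]] [j [t [Pt ->]]]; exists (i + j)%N, (s * t).
  by split; [move=> /PM[]|rewrite exprD; ring].
- move=> _ -> [i [s [Ps]]].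
  rewrite -(mulr0 (b ^+ i)) => /(@GRing.lregX _ _ i bnzd).
  by move=> s0; apply: Ps; rewrite -s0; exact: ideal0.
have P0P : P0 `<` P.
  split=> [x P0x|PP0].
    by apply: contrapT => Px; apply: (P0A _ P0x); exists 0%N, x; rewrite mul1r.
  apply: (P0A _ (PP0 _ Pb)); exists 1%N, 1; by rewrite mulr1.
have : ((2%:Z)%:E <= krull_dim R)%E.
  apply: (@natsup_ge (fun n => exists c : nat -> set R,
         (forall i, (i <= n)%N -> is_prime (c i)) /\
         (forall i, (i < n)%N -> c i `<` c i.+1)) 2%N).
  exists (fun i => if i is i'.+1 then if i' is 0%N then P else m else P0).
  split=> [[|[|[|]]]|[|[|]]] //= _.
  by apply: maximal_prime; case: locm.
by rewrite dim1 lee_fin.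
Qed.

(** Every ideal containing a non-zerodivisor has finite colength. *)
Lemma dim1_finite_colength m b J : noetherian R -> is_local m ->
  krull_dim R = 1%:E%E -> GRing.lreg b -> is_ideal J -> J b ->
  @finlen R R^o J [set: R].
Proof.
move=> noeth locm dim1 bnzd; apply: finite_colength => // P.
exact: (dim1_prime_maximal noeth locm dim1 bnzd).
Qed.

(** Every proper ideal containing a non-zerodivisor is primary to m. *)
Lemma dim1_primary m b J : noetherian R -> is_local m ->
  krull_dim R = 1%:E%E -> GRing.lreg b -> is_ideal J -> J b -> J `<=` m ->
  primary_to m J.
Proof.
move=> noeth locm dim1 bnzd iJ Jb Jm.
have finJ := dim1_finite_colength noeth locm dim1 bnzd iJ Jb.
have primem : is_prime m by apply: maximal_prime; case: locm.
have [im mT mM] := primem.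
have radJ : radical J = m.
  apply/seteqP; split=> x; last exact: finlen_pow.
  move=> [i /Jm]; elim: i => [|i IHi]; first by move=> /(ideal_1 im).
  by rewrite exprS => /mM[].
split=> //; split=> // [JT|x y Jxy].
  by apply: mT; apply/seteqP; split=> // x _; apply: Jm; rewrite JT.
have [my|my] := pselect (m y); first by right; rewrite radJ.
left; have [z yz] := local_unit noeth locm my.
by rewrite -[x]mulr1 -yz (_ : _ * _ = z * (x * y)); [exact: idealM|ring].
Qed.

End CohenMacaulay.

(** * Colengths of ideals *)

Section Colength.
Variable R : comNzRingType.
Implicit Types (J K : set R).

(** The length of R / J. *)
Definition colen J : \bar int := natsup (@chain R R^o J [set: R]).

Lemma colen_haslen J n : @haslen R R^o J [set: R] n -> colen J = (n%:Z)%:E.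
Proof. by move=> [? ?]; exact: natsup_max. Qed.

Lemma colen_natinf J : is_ideal J -> natinf (colen J).
Proof. by move=> iJ; apply: natsup_natinf; exists 0%N; exact: chain0. Qed.

Lemma colen_finlen J n : (colen J <= (n%:Z)%:E)%E -> @finlen R R^o J [set: R].
Proof.
move=> le_n; exists n => k /(@natsup_ge (@chain R R^o J [set: R])) ck.
by rewrite -lee_nat; exact: le_trans ck le_n.
Qed.

Lemma colen_subset J K n : is_ideal J -> is_ideal K -> J `<=` K ->
  @haslen R R^o J [set: R] n -> @haslen R R^o K [set: R] n -> K `<=` J.
Proof.
move=> iJ iK JK [_ mJ] [cK _]; apply: contrapT => nKJ.
suff /mJ : @chain R R^o J [set: R] (1 + n) by rewrite ltnn.
by apply: (chain_cat _ _ _ cK) => //; apply: chain1.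
Qed.

End Colength.

(** * Multiplication of ideals by elements of the total quotient ring *)

Section Scaling.
Variables (R Q : comNzRingType) (iota : {rmorphism R -> Q}).
Hypothesis hQ : is_total_quotient_ring iota.
Implicit Types (J D : set R) (alpha beta : Q).

Let iota_inj : injective iota. Proof. by case: hQ. Qed.

Lemma tq_unit b : GRing.lreg b -> exists c, iota b * c = 1.
Proof. by case: hQ => _ + _; apply. Qed.

Lemma tq_cancel b q q' : GRing.lreg b -> q * iota b = q' * iota b -> q = q'.
Proof.
move=> /tq_unit[c bc] qb.
by rewrite -[q]mulr1 -[q']mulr1 -bc !mulrA qb.
Qed.

Lemma tq_lreg alpha alpha' c c' : alpha * alpha' = 1 -> GRing.lreg c ->
  iota c' = alpha * iota c -> GRing.lreg c'.
Proof.
move=> aa cnzd c'E x y /(congr1 iota); rewrite !rmorphM c'E.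
move=> /(congr1 ( *%R alpha')); rewrite !mulrA [alpha' * _]mulrC aa !mul1r.
by rewrite -!rmorphM => /iota_inj; exact: cnzd.
Qed.

(** The set of the elements of R whose image lies in alpha J; this is alpha J
    itself when alpha J is contained in R. *)
Definition smul alpha J : set R :=
  [set r | exists2 x, J x & iota r = alpha * iota x].

Lemma smul_ideal alpha J : is_ideal J -> is_ideal (smul alpha J).
Proof.
move=> iJ; apply/idealP; split.
  by exists 0; [exact: ideal0|rewrite !rmorph0 mulr0].
move=> a x y [u Ju xE] [v Jv yE]; exists (a * u + v).
  by apply: idealD => //; exact: idealM.
by rewrite !rmorphD !rmorphM xE yE; ring.
Qed.

Lemma smulS alpha J D : J `<=` D -> smul alpha J `<=` smul alpha D.
Proof. by move=> JD r [x Jx rE]; exists x => //; exact: JD. Qed.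

Lemma image_smul alpha J : colon iota J alpha ->
  iota @` smul alpha J = [set alpha * x | x in iota @` J].
Proof.
move=> colJ; apply/seteqP; split=> [_ [r [x Jx rE] <-]|_ [_ [x Jx <-] <-]].
  by exists (iota x) => //; exists x.
by have [r _ rE] := colJ x Jx; exists r => //; exists x.
Qed.

Lemma smulA alpha beta J : colon iota J beta ->
  smul alpha (smul beta J) = smul (alpha * beta) J.
Proof.
move=> colJ; apply/seteqP; split=> [r [s [x Jx sE] rE]|r [x Jx rE]].
  by exists x => //; rewrite rE sE mulrA.
have [s _ sE] := colJ x Jx; exists s; first by exists x.
by rewrite rE sE mulrA.
Qed.

Lemma smul1 J : smul 1 J = J.
Proof.
apply/seteqP; split=> [r [x Jx]|r Jr]; first by rewrite mul1r => /iota_inj ->.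
by exists r; rewrite ?mul1r.
Qed.

Lemma colon_smul alpha beta J : colon iota J (alpha * beta) ->
  colon iota (smul beta J) alpha.
Proof.
move=> colJ r [x Jx rE]; have [s _ sE] := colJ x Jx.
by exists s => //; rewrite sE rE mulrA.
Qed.

Lemma colon_lin (u w : R) alpha J : is_ideal J -> colon iota J alpha ->
  colon iota J (iota u + iota w * alpha).
Proof.
move=> iJ colJ x Jx; have [s _ sE] := colJ x Jx.
by exists (u * x + w * s) => //; rewrite rmorphD !rmorphM sE; ring.
Qed.

(** * Integrality and stable ideals *)

(** alpha D is contained in D. *)
Definition stable alpha D :=
  D `<=` [set x | exists2 y, D y & alpha * iota x = iota y].

(** Cayley-Hamilton: an element of the total quotient ring stabilizing an ideal
    that contains a non-zerodivisor is integral. *)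
Lemma stable_integral alpha D t : noetherian R -> is_ideal D -> D t ->
  GRing.lreg t -> stable alpha D -> integralOver iota alpha.
Proof.
move=> noeth iD Dt tnzd stabD; have [s Ds] := noeth D iD.
set n := size s in Ds.
have /choice[a aE] (i : 'I_n) : exists a : 'I_n -> R,
    alpha * iota s`_i = iota (\sum_(j < n) a j * s`_j).
  have [|y] := stabD s`_i; first by rewrite Ds; exact: mem_mspan.
  by rewrite Ds => -[a ->] ->; exists a.
pose A : 'M[R]_n := \matrix_(i, j) a i j.
pose B : 'M[Q]_n := alpha%:M - map_mx iota A.
pose v : 'cV[Q]_n := \col_i iota s`_i.
have Bv : B *m v = 0.
  apply/eqP; rewrite mulmxBl mul_scalar_mx subr_eq0; apply/eqP/colP => i.
  rewrite !mxE aE rmorph_sum; apply: eq_bigr => j _.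
  by rewrite !mxE rmorphM.
have detv i : \det B * iota s`_(i : 'I_n) = 0.
  have : \det B *: v = 0.
    by rewrite -mul_scalar_mx -mul_adj_mx -mulmxA Bv mulmx0.
  by move=> /colP/(_ i); rewrite !mxE.
have detB : \det B = 0.
  apply: (tq_cancel tnzd); rewrite mul0r; move: Dt; rewrite Ds => -[c ->].
  rewrite rmorph_sum mulr_sumr big1// => i _.
  by rewrite rmorphM mulrCA detv mulr0.
exists (char_poly A); first exact: char_poly_monic.
rewrite rootE -detB -horner_evalE -2!det_map_mx; apply/eqP; congr (\det _).
rewrite raddfB /= map_scalar_mx; apply/matrixP => i j.
by rewrite !mxE raddfB raddfMn /= map_polyX map_polyC /horner_eval !hornerE.
Qed.

(** Conversely, an integral element stabilizes an ideal containing a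
    non-zerodivisor inside any ideal J with this property: if alpha = a / b is
    a root of a monic polynomial of degree n, then alpha ^ i * b ^ n lies in R
    for all i, and one takes for D the set of the x such that alpha ^ i * x is
    in J for all i. *)
Lemma integral_stable alpha J c : is_ideal J -> J c -> GRing.lreg c ->
  integralOver iota alpha ->
  exists D t, [/\ is_ideal D, D `<=` J, D t, GRing.lreg t & stable alpha D].
Proof.
move=> iJ Jc cnzd [p pmonic proot].
have [_ _ /(_ alpha)[a [b [bnzd abE]]]] := hQ.
pose D := [set x | forall i, exists2 y, J y & alpha ^+ i * iota x = iota y].
pose n := (size p).-1.
exists D, (b ^+ n * c); split.
- apply/idealP; split.
    by move=> i; exists 0; [exact: ideal0|rewrite rmorph0 mulr0].
  move=> r x y Dx Dy i; have [u Ju uE] := Dx i; have [v Jv vE] := Dy i.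
  exists (r * u + v); first by apply: idealD => //; exact: idealM.
  by rewrite !rmorphD !rmorphM -uE -vE; ring.
- by move=> x /(_ 0%N)[y Jy]; rewrite expr0 mul1r => /iota_inj ->.
- move=> i; elim/ltn_ind: i => i IHi.
  have [lti|lei] := leqP i n.
    exists (a ^+ i * b ^+ (n - i) * c); first exact: idealM.
    have -> : b ^+ n = b ^+ i * b ^+ (n - i) by rewrite -exprD subnKC.
    rewrite !rmorphM !mulrA; congr (_ * _ * _).
    by rewrite !rmorphXn -abE exprMn.
  have alphaE : alpha ^+ i = - \sum_(j < n) iota p`_j * alpha ^+ (j + (i - n)).
    have : \sum_(j < n.+1) iota p`_j * alpha ^+ j = 0.
      move/rootP: proot; rewrite (@horner_coef_wide _ n.+1).
        move=> sum0; rewrite -[RHS]sum0.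
        by apply: eq_bigr => j _; rewrite coef_map.
      by rewrite /n prednK ?size_poly_gt0 ?monic_neq0// size_poly.
    have pn : p`_n = 1 by exact: (monicP pmonic).
    rewrite big_ord_recr /= pn rmorph1 mul1r.
    move=> /eqP; rewrite addrC addr_eq0 => /eqP alphan.
    rewrite -{1}(subnKC (ltnW lei)) exprD alphan mulNr mulr_suml; congr (- _).
    by apply: eq_bigr => j _; rewrite -mulrA -exprD.
  have /choice[y yP] (j : 'I_n) : exists y, J y /\
      alpha ^+ (j + (i - n)) * iota (b ^+ n * c) = iota y.
    have [|y Jy yE] := IHi (j + (i - n))%N; last by exists y.
    by have := ltn_ord j; lia.
  exists (- \sum_(j < n) p`_j * y j).
    rewrite -[- _]add0r; apply: idealB => //; first exact: ideal0.
    apply: (@submodule_sum R R^o) => // j _.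
    by apply: idealM => //; case: (yP j).
  rewrite alphaE rmorphN mulNr mulr_suml rmorph_sum; congr (- _).
  by apply: eq_bigr => j _; rewrite [RHS]rmorphM -mulrA; have [_ ->] := yP j.
- by apply: GRing.lregM => //; exact: GRing.lregX.
- move=> x Dx; have [y Jy yE] := Dx 1%N; exists y; last by rewrite -yE expr1.
  move=> i; have [z Jz zE] := Dx i.+1; exists z => //.
  by rewrite -yE -zE expr1 exprSr mulrA.
Qed.

(** * Colength and integrality *)

Section Comparison.
Hypothesis noeth : noetherian R.
Hypothesis finite : forall J b, is_ideal J -> J b -> GRing.lreg b ->
  @finlen R R^o J [set: R].
Variables (alpha : Q) (J : set R) (c : R).
Hypotheses (iJ : is_ideal J) (Jc : J c) (cnzd : GRing.lreg c).
Hypothesis colJ : colon iota J alpha.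

(** alpha J / alpha D is an epimorphic image of J / D. *)
Lemma smul_chain D n : is_ideal D -> D `<=` J ->
  @chain R R^o (smul alpha D) (smul alpha J) n -> @chain R R^o D J n.
Proof.
move=> iD DJ; pose phi X : set R :=
  [set x | J x /\ exists2 y, X y & iota y = alpha * iota x].
apply: (@chain_transport _ _ R^o R^o _ _ _ _ phi) =>
    [X sX DX XJ|X Y XY x|X Y sX sY DX DY XJ YJ YX y Yy].
- split=> [|x Dx|x []//].
    apply/idealP; split.
      split; first exact: ideal0.
      by exists 0; [exact: (@ideal0 _ X)|rewrite !rmorph0 mulr0].
    move=> a x x' [Jx [y Xy yE]] [Jx' [y' Xy' yE']]; split.
      by apply: idealD => //; exact: idealM.
    exists (a * y + y').
      by apply: (@idealD _ X) => //; exact: (@idealM _ X).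
    by rewrite !rmorphD !rmorphM yE yE'; ring.
  split; first exact: DJ.
  have [y _ yE] := colJ (DJ _ Dx); exists y => //.
  by apply: DX; exists x.
- by move=> [Jx [y Xy yE]]; split=> //; exists y => //; exact: XY.
- have [x Jx yE] := YJ _ Yy.
  have [|_ [y' Xy' yE']] := YX x; first by split=> //; exists y.
  by rewrite (_ : y = y')//; apply: iota_inj; rewrite yE.
Qed.

Lemma stable_smul_sub D : D `<=` J -> stable alpha D -> smul alpha D `<=` D.
Proof.
by move=> DJ stabD r [x Dx rE]; have [y Dy yE] := stabD x Dx;
  rewrite (_ : r = y)//; apply: iota_inj; rewrite rE.
Qed.

(** The two bounds on colengths: with r the length of J / D, the colength of D
    is r + l(R/J) and that of alpha D is at most r + l(R/alpha J). *)
Lemma stable_colength D t p q : is_ideal D -> D `<=` J -> D t -> GRing.lreg t ->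
  stable alpha D -> @haslen R R^o J [set: R] p ->
  @haslen R R^o (smul alpha J) [set: R] q ->
  exists r, [/\ @haslen R R^o D [set: R] (r + p),
    forall k, @chain R R^o (smul alpha D) [set: R] k -> (k <= r + q)%N &
    smul alpha D `<=` D].
Proof.
move=> iD DJ Dt tnzd stabD lenJ lenaJ.
have finD := finite iD Dt tnzd.
have [r lenDJ] : exists r, @haslen R R^o D J r.
  by apply: finlenP => //; apply: finlenW finD.
exists r; split; last exact: stable_smul_sub.
  by apply: haslen_add lenDJ lenJ => //; exact: idealT.
move=> k /(@chain_split R R^o _ (smul alpha J)).
case=> [||||| k1 [k2 [kle /smul_chain c1 /lenaJ.2 c2]]].
- exact: smul_ideal.
- exact: smul_ideal.
- exact: smulS.
- by [].
- exact: idealT.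
- by have := lenDJ.2 _ (c1 iD DJ); lia.
Qed.

(** Multiplication by an integral element does not decrease the colength. *)
Lemma integral_colength_le : integralOver iota alpha ->
  (colen J <= colen (smul alpha J))%E.
Proof.
move=> inta.
have [D [t [iD DJ Dt tnzd stabD]]] := integral_stable iJ Jc cnzd inta.
have [->|[q qE]] := colen_natinf (smul_ideal alpha iJ); first by rewrite leey.
have [q' lenaJ] : exists q, @haslen R R^o (smul alpha J) [set: R] q.
  apply: finlenP => //; first exact: smul_ideal.
  by apply: (@colen_finlen _ _ q); rewrite qE.
have [p lenJ] := finlenP iJ (@subsetT _ _) (finite iJ Jc cnzd).
rewrite (colen_haslen lenJ) (colen_haslen lenaJ) lee_nat.
have [r [lenD leaD aDD]] := stable_colength iD DJ Dt tnzd stabD lenJ lenaJ.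
have := leaD (r + p)%N; rewrite leq_add2l; apply.
by apply: chainW lenD.1.
Qed.

(** If the colength is unchanged, then alpha D = D for the stable ideal D, so
    that the inverse of alpha stabilizes D. *)
Lemma integral_colength_eq alpha' : alpha * alpha' = 1 ->
  integralOver iota alpha -> colen (smul alpha J) = colen J ->
  integralOver iota alpha'.
Proof.
move=> aa inta eqlen.
have [D [t [iD DJ Dt tnzd stabD]]] := integral_stable iJ Jc cnzd inta.
have [p lenJ] := finlenP iJ (@subsetT _ _) (finite iJ Jc cnzd).
have [q lenaJ] : exists q, @haslen R R^o (smul alpha J) [set: R] q.
  apply: finlenP => //; first exact: smul_ideal.
  by apply: (@colen_finlen _ _ p); rewrite eqlen (colen_haslen lenJ).
have qp : q = p.
  move: eqlen; rewrite (colen_haslen lenJ) (colen_haslen lenaJ) => -[].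
  by lia.
rewrite qp in lenaJ.
have [r [lenD leaD aDD]] := stable_colength iD DJ Dt tnzd stabD lenJ lenaJ.
apply: (stable_integral noeth iD Dt tnzd) => x Dx.
have [y Dy xE] : smul alpha D x.
  move: Dx; apply: (@colen_subset _ (smul alpha D) D (r + p)) => //.
  - exact: smul_ideal.
  - by split=> //; apply: chainW lenD.1.
by exists y => //; rewrite xE mulrA [alpha' * _]mulrC aa mul1r.
Qed.

End Comparison.

End Scaling.

(** * Partial trace ideals *)

Section Traces.
Variables (R : comNzRingType) (M : lmodType R).
Implicit Types f g : {linear M -> R^o}.

Lemma ideal_im f : is_ideal (range f).
Proof. exact: im_ideal_closed. Qed.

Lemma mlength_im f : mlength (mquot (im_ideal f)) = colen (range f).
Proof.
rewrite mlength_mquot /colen; congr (natsup (chain _ _)).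
by apply/seteqP; split=> v; [exact: set_mem|exact: mem_set].
Qed.

(** The least colength h(M) is attained. *)
Lemma trace_colengthP :
  (exists f, colen (range f) = trace_colength M) /\
  forall f, (trace_colength M <= colen (range f))%E.
Proof.
rewrite /trace_colength; set A := [set _ | _ in _].
have [||[f _ fE] lb] := @infimum_isGlb A.
- move=> _ [f _ <-]; rewrite mlength_im; apply: colen_natinf; exact: ideal_im.
- by exists (mlength (mquot (im_ideal (\0 : {linear M -> R^o})))), \0.
split; first by exists f; rewrite -mlength_im.
by move=> g; apply: lb; exists g => //; exact: mlength_im.
Qed.

Lemma partial_traceP (J : set R) :
  partial_trace_ideal M J <->
  exists f, J = range f /\ colen J = trace_colength M.
Proof. by split=> -[f [-> fE]]; exists f; move: fE; rewrite mlength_im. Qed.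

Variables (Q : comNzRingType) (iota : {rmorphism R -> Q}).
Hypothesis iota_inj : injective iota.

Lemma linear_smul f alpha : colon iota (range f) alpha ->
  exists g, range g = smul iota alpha (range f).
Proof.
move=> colf.
have /choice[g gE] (x : M) : exists y : R^o, iota y = alpha * iota (f x).
  by have [|y _ yE] := colf (f x); [exists x|exists y].
have glin : linear g.
  move=> a x y; apply: iota_inj; rewrite rmorphD gE linearP rmorphD.
  rewrite [iota (a *: g x)]rmorphM [iota (a *: f x)]rmorphM !gE.
  by rewrite mulrDr mulrCA.
pose gM := GRing.isLinear.Build R M R^o *:%R g glin.
pose G : {linear M -> R^o} := HB.pack g gM.
exists G; apply/seteqP; split=> [_ [x _ <-]|r [_ [x _ <-] rE]].
  by exists (f x); [exists x|exact: gE].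
by exists x => //; apply: iota_inj; rewrite rE; exact: gE.
Qed.

End Traces.

Section IdealTraces.
Variables (R Q : comNzRingType) (iota : {rmorphism R -> Q}) (I : ideal R).
Hypothesis hQ : is_total_quotient_ring iota.

Let iota_inj : injective iota. Proof. by case: hQ. Qed.

(** The inclusion of I in R. *)
Definition ideal_val : ideal_mod I -> R^o := \val.

Lemma range_val : range ideal_val = iset I.
Proof.
apply/seteqP; split=> [_ [x _ <-]|x Ix]; first exact: (valP x).
by exists (exist _ x Ix).
Qed.

Fact ideal_val_linear : linear ideal_val.
Proof. by []. Qed.
HB.instance Definition _ := GRing.isLinear.Build R (ideal_mod I) R^o *:%R
  ideal_val ideal_val_linear.

Lemma ideal_mod_fg : noetherian R -> finitely_generated (ideal_mod I).
Proof.
move=> noeth; have [s Is] := noeth _ (ideal_iset I).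
have sI i : (i < size s)%N -> s`_i \in I.
  move=> lti; suff : iset I s`_i by [].
  by rewrite Is; exact: mem_mspan.
pose s' : seq (ideal_mod I) := pmap insub s.
have val_s' : map val s' = s.
  rewrite pmap_filter; last exact: insubK.
  apply/all_filterP/allP => x xs; rewrite isSome_insub.
  by rewrite -(nth_index 0 xs); apply: sI; rewrite index_mem.
exists s'; apply/seteqP; split=> // x _.
have sz : size s = size s' by rewrite -[in LHS]val_s' size_map.
have : iset I (val x) by exact: (valP x).
rewrite Is => -[c xE].
exists (fun i => c (cast_ord (esym sz) i)).
apply: val_inj; rewrite xE (raddf_sum ideal_val) /=.
rewrite (reindex (cast_ord (esym sz))) /=; last first.
  by exists (cast_ord sz) => i _; rewrite ?cast_ordK ?cast_ordKV.
apply: eq_bigr => i _; rewrite linearZ /=; congr (_ *: _).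
by rewrite -[in LHS]val_s' (nth_map 0)// ltn_ord.
Qed.

(** Every homomorphism from I to R is the multiplication by an element of
    R : I. *)
Lemma linear_idealE c (f : {linear ideal_mod I -> R^o}) :
  iset I c -> GRing.lreg c ->
  exists2 alpha, colon iota (iset I) alpha & range f = smul iota alpha (iset I).
Proof.
move=> Ic cnzd; have [c' cc] := tq_unit hQ cnzd.
pose C : ideal_mod I := exist _ c Ic.
pose alpha := iota (f C) * c'.
have fE (x : ideal_mod I) : iota (f x) = alpha * iota (val x).
  apply: (tq_cancel hQ cnzd).
  have -> : alpha * iota (val x) * iota c =
      iota (f C) * iota (val x) * (iota c * c').
    by rewrite /alpha; ring.
  rewrite cc mulr1 -!rmorphM; congr (iota _).
  have : f (c *: x) = f ((val x : R) *: C).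
    by congr (f _); apply: val_inj; exact: (@mulrC R).
  by rewrite !linearZ /= => fxC; rewrite mulrC [RHS]mulrC; exact: fxC.
exists alpha.
  by move=> x Ix; exists (f (exist _ x Ix)) => //; rewrite fE.
apply/seteqP; split=> [_ [x _ <-]|r [x Ix rE]].
  by exists (val x); [exact: (valP x)|exact: fE].
by exists (exist _ x Ix) => //; apply: iota_inj; rewrite fE rE.
Qed.

End IdealTraces.

(** * Discrete valuation rings *)

Section DVR.
Variables (S : comNzRingType) (n : set S).
Hypothesis dvrS : is_dvr n.

Lemma dvr_noetherian : noetherian S.
Proof.
move=> J iJ; have [_ /(_ J iJ)[a ->] _ _] := dvrS; exists [:: a : S^o].
apply/seteqP; split=> [_ [x _ <-]|_ [c ->]].
  by exists (fun=> x); rewrite big_ord_recl big_ord0 addr0 /= mulrC.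
by exists (c ord0) => //; rewrite big_ord_recl big_ord0 addr0 /= mulrC.
Qed.

Lemma dvr_finite_colength (x : S) J : x != 0 -> is_ideal J -> J x ->
  @finlen S S^o J [set: S].
Proof.
have [dom pid locn nn0] := dvrS; move=> x0 iJ Jx.
apply: (finite_colength dvr_noetherian _ iJ Jx) => P primeP Px.
have [iP PT PM] := primeP.
suff -> : P = n by case: locn.
have [[in_ nT _] _] := locn.
have Pn := local_sub dvr_noetherian locn iP PT.
apply/seteqP; split=> //.
have [p pE] := pid P iP; have [q qE] := pid n in_.
have Pp : P p by rewrite pE; exists 1; rewrite ?mulr1.
have [c _ pqc] : range ( *%R q) p by rewrite -qE; exact: Pn.
have [Pq|Pc] : P q \/ P c by apply: PM; rewrite pqc.
  by rewrite qE => _ [y _ <-]; rewrite mulrC; exact: idealM.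
exfalso; move: Pc; rewrite pE => -[d _ cpd].
have [p0|] : p = 0 \/ 1 - q * d = 0.
  by apply: dom; rewrite mulrBr mulr1 mulrCA cpd pqc subrr.
  by move: Px x0; rewrite pE => -[y _ <-]; rewrite p0 mul0r eqxx.
move/eqP; rewrite subr_eq0 => /eqP qd; apply: nT; apply: ideal_1 => //.
by rewrite qE qd; exists d.
Qed.

Lemma dvr_dvd_total (x y : S) : range ( *%R x) y \/ range ( *%R y) x.
Proof.
have [dom pid locn _] := dvrS.
have [[in_ nT _] _] := locn.
have iA := ideal_adjoin y (ideal_range x).
have [g gE] := pid _ iA.
have [x' _ xE] : range ( *%R g) x.
  by rewrite -gE; apply: sub_adjoin; exists 1; rewrite ?mulr1.
have [y' _ yE] : range ( *%R g) y.
  by rewrite -gE; apply: mem_adjoin; exact: ideal_range.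
have [_ [r [[u _ <-] ge]]] : adjoin (range ( *%R x)) y g.
  by rewrite gE; exists 1; rewrite ?mulr1.
have [g0|] : g = 0 \/ 1 - (x' * u + r * y') = 0.
- by apply: dom; rewrite mulrBr mulr1 {1}ge -xE -yE; ring.
- by left; exists 0; rewrite // mulr0 -yE g0 mul0r.
move/eqP; rewrite subr_eq0 => /eqP one.
have [nx|/(local_unit dvr_noetherian locn)[z xz]] := pselect (n x'); last first.
  by left; exists (z * y') => //; rewrite -xE -yE -mulrA [x' * _]mulrA xz mul1r.
have [ny|/(local_unit dvr_noetherian locn)[z yz]] := pselect (n y'); last first.
  right; exists (z * x') => //.
  by rewrite -xE -yE -mulrA [y' * _]mulrA yz mul1r.
case: nT; apply: ideal_1 => //; rewrite one mulrC.
by apply: idealD => //; exact: idealM.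
Qed.

(** Colength separates the nonzero principal ideals, which form a chain. *)
Lemma dvr_colen_inj (x y : S) : y != 0 ->
  colen (range ( *%R x)) = colen (range ( *%R y)) ->
  range ( *%R x) = range ( *%R y).
Proof.
move=> y0 eqlen.
have mem (z : S) : range ( *%R z) z by exists 1; rewrite ?mulr1.
have [N lenN] : exists N, @haslen S S^o (range ( *%R y)) [set: S] N.
  apply: finlenP; [exact: ideal_range|exact: subsetT|].
  exact: (dvr_finite_colength y0 (ideal_range y) (mem y)).
have lenx : @haslen S S^o (range ( *%R x)) [set: S] N.
  have [|k lenk] := @finlenP S S^o (range ( *%R x)) [set: S]
      (ideal_range x) (@subsetT _ _).
    by apply: (@colen_finlen _ _ N); rewrite eqlen (colen_haslen lenN).
  move: eqlen; rewrite (colen_haslen lenN) (colen_haslen lenk) => -[kN].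
  by rewrite -(_ : k = N)//; lia.
have sub (u v : S) : range ( *%R u) v -> range ( *%R v) `<=` range ( *%R u).
  move=> uv _ [w _ <-]; rewrite mulrC.
  by apply: idealM => //; exact: ideal_range.
have [/sub s|/sub s] := dvr_dvd_total x y; apply/seteqP; split=> //.
  by apply: (colen_subset (ideal_range _) (ideal_range _) s lenN lenx).
by apply: (colen_subset (ideal_range _) (ideal_range _) s lenx lenN).
Qed.

End DVR.

Section Valuation.
Variables (R Q : comNzRingType) (iota : {rmorphism R -> Q}).
Hypothesis hQ : is_total_quotient_ring iota.
Variable n : set (Rbar iota).
Hypothesis dvr : is_dvr n.

Lemma RbarP (s : Rbar iota) : integralOver iota (val s).
Proof. exact: (set_mem (valP s)). Qed.

Lemma ex_Rbar alpha :
  integralOver iota alpha -> exists s : Rbar iota, val s = alpha.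
Proof. by move=> inta; exists (exist _ alpha (mem_set inta)). Qed.

Lemma colengthbarE a :
  colengthbar iota a = colen (range ( *%R (iotabar iota a))).
Proof.
rewrite /colengthbar mlength_mquot /colen; congr (natsup (chain _ _)).
by apply/seteqP; split=> v; [exact: set_mem|exact: mem_set].
Qed.

Lemma iotabar_neq0 b : GRing.lreg b -> iotabar iota b != 0.
Proof.
move=> /(tq_unit hQ)[c bc]; apply/eqP => /(congr1 val) /= b0.
by have := oner_neq0 Q; rewrite -bc b0 mul0r eqxx.
Qed.

Lemma colengthbar_fin b :
  GRing.lreg b -> exists N : nat, colengthbar iota b = (N%:Z)%:E.
Proof.
move=> bnzd.
have [|N lenN] := @finlenP _ (Rbar iota)^o
    (range ( *%R (iotabar iota b))) [set: Rbar iota] (ideal_range _) (@subsetT _ _).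
  apply: (dvr_finite_colength dvr (iotabar_neq0 bnzd)).
    exact: ideal_range.
  by exists 1; rewrite ?mulr1.
by exists N; rewrite colengthbarE (colen_haslen lenN).
Qed.

Lemma integral_or_inv alpha : integralOver iota alpha \/
  exists2 alpha', alpha * alpha' = 1 & integralOver iota alpha'.
Proof.
have [_ _ /(_ alpha)[a [b [bnzd abE]]]] := hQ.
have [c bc] := tq_unit hQ bnzd.
have [[s _ /(congr1 val) /= bs]|[s _ /(congr1 val) /= bs]] :=
  dvr_dvd_total dvr (iotabar iota a) (iotabar iota b).
  right; exists (val s); last exact: RbarP.
  by apply: (tq_cancel hQ bnzd); rewrite mul1r -[RHS]bs -abE mulrAC.
left; rewrite (_ : alpha = val s); first exact: RbarP.
by apply: (tq_cancel hQ bnzd); rewrite abE -bs mulrC.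
Qed.

(** The elements of value zero are the units of the integral closure. *)
Lemma valuation_eq0 alpha : valuation iota alpha = 0%E <->
  integralOver iota alpha /\
  exists2 alpha', alpha * alpha' = 1 & integralOver iota alpha'.
Proof.
rewrite /valuation; set Z := [set z | _].
have Zne : exists z, Z z.
  have [_ _ /(_ alpha)[a [b [bnzd abE]]]] := hQ.
  by exists (colengthbar iota a - colengthbar iota b)%E, a, b.
split=> [z0|[inta [alpha' aa inta']]].
  have [a [b [bnzd abE]]] := xgetPex +oo%E Zne; rewrite z0 => len0.
  have eqlen : colen (range ( *%R (iotabar iota a))) =
      colen (range ( *%R (iotabar iota b))).
    rewrite -!colengthbarE; have [N NE] := colengthbar_fin bnzd.
    move: len0; rewrite NE; case: (colengthbar iota a) => [r||] // -[rN].
    by congr (_%:E); lia.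
  have eqr := dvr_colen_inj dvr (iotabar_neq0 bnzd) eqlen.
  have [s _ /(congr1 val) /= as_] :
      range ( *%R (iotabar iota b)) (iotabar iota a).
    by rewrite -eqr; exists 1; rewrite ?mulr1.
  have [r _ /(congr1 val) /= br] :
      range ( *%R (iotabar iota a)) (iotabar iota b).
    by rewrite eqr; exists 1; rewrite ?mulr1.
  split.
    rewrite (_ : alpha = val s); first exact: RbarP.
    by apply: (tq_cancel hQ bnzd); rewrite abE -as_ mulrC.
  exists (val r); last exact: RbarP.
  by apply: (tq_cancel hQ bnzd); rewrite mul1r -[RHS]br -abE mulrAC.
have [s sE] := ex_Rbar inta; have [r rE] := ex_Rbar inta'.
have [a [b [bnzd abE ->]]] := xgetPex +oo%E Zne.
have eqr : range ( *%R (iotabar iota a)) = range ( *%R (iotabar iota b)).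
  apply/seteqP; split=> _ [w _ <-].
    by exists (s * w) => //; apply: val_inj; rewrite /= sE -abE; ring.
  exists (r * w) => //; apply: val_inj; rewrite /= rE -abE.
  by rewrite -[RHS]mul1r -aa; ring.
have [N NE] := colengthbar_fin bnzd.
by rewrite colengthbarE eqr -colengthbarE NE -EFinB subrr.
Qed.

End Valuation.

(** * Products of ideals and principal reductions *)

Section Reductions.
Variable R : comNzRingType.
Implicit Types (J K : set R).

Lemma ideal_ideal_mul K J : is_ideal K -> is_ideal (ideal_mul K J).
Proof.
move=> iK; apply/idealP; split; first by exists [::]; rewrite big_nil.
move=> a _ _ [s [sKJ ->]] [s' [s'KJ ->]].
exists ([seq (a * p.1, p.2) | p <- s] ++ s'); split.
  move=> p; rewrite mem_cat => /orP[/mapP[q /sKJ[? ?] ->]|/s'KJ//].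
  by split=> //; exact: idealM.
rewrite big_cat big_map mulr_sumr /=; congr (_ + _).
by apply: eq_bigr => p _; rewrite mulrA.
Qed.

Lemma mem_ideal_mul K J x y : K x -> J y -> ideal_mul K J (x * y).
Proof.
move=> Kx Jy; exists [:: (x, y)]; rewrite big_seq1; split=> // p.
by rewrite inE => /eqP->.
Qed.

Lemma ideal_ideal_exp K n : is_ideal K -> is_ideal (ideal_exp K n).
Proof. by case: n => [|n] iK; [exact: idealT|exact: ideal_ideal_mul]. Qed.

Lemma mem_ideal_exp K x n : K x -> ideal_exp K n (x ^+ n).
Proof.
by move=> Kx; elim: n => // n IHn; rewrite exprS; exact: mem_ideal_mul.
Qed.

Variables (Q : comNzRingType) (iota : {rmorphism R -> Q}).
Hypothesis hQ : is_total_quotient_ring iota.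
Hypothesis noeth : noetherian R.

(** A principal reduction (a) of an ideal K with a non-zerodivisor d is
    generated by a non-zerodivisor, and x / a is integral for all x in K. *)
Lemma principal_reduction_integral K d : is_ideal K -> K d -> GRing.lreg d ->
  has_principal_reduction K ->
  exists a a', [/\ K a, GRing.lreg a, iota a * a' = 1 &
    forall x, K x -> integralOver iota (iota x * a')].
Proof.
move=> iK Kd dnzd [a [Ka [n redE]]].
have dnnzd k : GRing.lreg (d ^+ k) by exact: GRing.lregX.
have anzd : GRing.lreg a.
  have := @mem_ideal_exp K d n.+1 Kd; rewrite redE => -[y _ ayE].
  move=> u v auv; apply: (dnnzd n.+1).
  by rewrite -ayE [a * y]mulrC -!mulrA auv.
have [a' aa] := tq_unit hQ anzd.
exists a, a'; split=> // x Kx.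
have iKn := @ideal_ideal_exp K n iK.
apply: (stable_integral hQ noeth iKn (mem_ideal_exp n Kd) (dnnzd n)) => y Ky.
have : ideal_exp K n.+1 (x * y) by exact: mem_ideal_mul.
rewrite redE => -[z Kz azE]; exists z => //.
by rewrite mulrAC -rmorphM -azE rmorphM mulrAC aa mul1r.
Qed.

End Reductions.

(** * Partial trace ideals in dimension one *)

Section Main.
Variables (R : comNzRingType) (m : ideal R).
Variables (Q : comNzRingType) (iota : {rmorphism R -> Q}) (I : ideal R).
Hypothesis hCM : cohen_macaulay_local (iset m).
Hypothesis hdim : krull_dim R = 1%:E%E.
Hypothesis hQ : is_total_quotient_ring iota.
Hypothesis hI : primary_to (iset m) (iset I).

Let noeth : noetherian R. Proof. by case: hCM. Qed.
Let locm : is_local (iset m). Proof. by case: hCM. Qed.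
Let iota_inj : injective iota. Proof. by case: hQ. Qed.
Let iI : is_ideal (iset I). Proof. exact: ideal_iset. Qed.

Let finite (J : set R) (b : R) :
  is_ideal J -> J b -> GRing.lreg b -> @finlen R R^o J [set: R].
Proof.
move=> iJ Jb bnzd.
exact: (dim1_finite_colength noeth locm hdim bnzd iJ Jb).
Qed.

(** An ideal of finite colength contains a non-zerodivisor. *)
Lemma finlen_nzd (J : set R) : is_ideal J -> @finlen R R^o J [set: R] ->
  exists2 c, J c & GRing.lreg c.
Proof.
move=> iJ finJ; have [b mb bnzd] := cohen_macaulay_nzd hCM hdim.
have [i Ji] := finlen_pow noeth locm iJ finJ mb.
by exists (b ^+ i) => //; exact: GRing.lregX.
Qed.

Lemma primary_nzd : exists2 c, iset I c & GRing.lreg c.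
Proof.
have [b mb bnzd] := cohen_macaulay_nzd hCM hdim.
have [_ radI] := hI; move: mb; rewrite -radI => -[i Ii].
by exists (b ^+ i) => //; exact: GRing.lregX.
Qed.

Lemma partial_trace_of_colon :
  colon iota (iset I) `<=` [set alpha | alpha \in integral_closure iota] ->
  partial_trace_ideal (ideal_mod I) (iset I).
Proof.
move=> colI; have [c Ic cnzd] := primary_nzd.
apply/partial_traceP; exists (@ideal_val R I); split; first by rewrite range_val.
have [[f fE] trle] := trace_colengthP (ideal_mod I).
apply/le_anti; rewrite -{2}(range_val I) trle andbT -fE.
have [alpha cola ->] := linear_idealE hQ f Ic cnzd.
apply: (integral_colength_le hQ finite iI Ic cnzd cola).
exact: set_mem (colI _ cola).
Qed.

Lemma colon_of_partial_trace (M : lmodType R) :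
  (forall K : set R, primary_to (iset m) K -> has_principal_reduction K) ->
  partial_trace_ideal M (iset I) ->
  colon iota (iset I) `<=` [set alpha | alpha \in integral_closure iota].
Proof.
move=> red /partial_traceP[f [fI lenI]] alpha cola; apply: mem_set.
have [c Ic cnzd] := primary_nzd.
have [b mb bnzd] := cohen_macaulay_nzd hCM hdim.
have im : is_ideal (iset m) by exact: ideal_iset.
have [_ _ /(_ alpha)[e0 [d0 [d0nzd alphaE]]]] := hQ.
(* alpha = e / d with d and e in m, after multiplying numerator and denominator
   by b; K is the ideal (d, e). *)
pose d := b * d0; pose e := b * e0.
have dnzd : GRing.lreg d by exact: GRing.lregM.
have deE : alpha * iota d = iota e by rewrite !rmorphM -alphaE; ring.
pose K := adjoin (range ( *%R d)) e.
have iK : is_ideal K by apply: ideal_adjoin; exact: ideal_range.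
have Kd : K d by apply: sub_adjoin; exists 1; rewrite ?mulr1.
have Ke : K e by apply: mem_adjoin; exact: ideal_range.
have Km : K `<=` iset m.
  move=> _ [_ [r [[u _ <-] ->]]]; apply: idealD => //.
    by rewrite /d mulrC mulrA [_ * b]mulrC -mulrA mulrC; exact: idealM.
  by apply: idealM => //; rewrite /e mulrC; exact: idealM.
have /red redK := dim1_primary noeth locm hdim dnzd iK Kd Km.
have [a [a' [Ka anzd aa inta]]] :=
  principal_reduction_integral hQ noeth iK Kd dnzd redK.
have [d' dd] := tq_unit hQ dnzd.
(* beta = a / d is a combination of 1 and alpha, and gamma is its inverse. *)
pose beta := iota a * d'; pose gamma := iota d * a'.
have gb : gamma * beta = 1.
  by rewrite /gamma /beta [iota a * _]mulrC mulrACA dd mul1r mulrC.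
have colb : colon iota (iset I) beta.
  have [_ [w [[u _ <-] aE]]] := Ka.
  rewrite (_ : beta = iota u + iota w * alpha); first exact: colon_lin.
  apply: (tq_cancel hQ dnzd); rewrite mulrDl -mulrA deE -!rmorphM -rmorphD.
  by rewrite /beta mulrAC -mulrA dd mulr1 aE [u * d]mulrC.
have colg1 : colon iota (iset I) (gamma * beta).
  by rewrite gb => x _; exists x => //; rewrite mul1r.
have colg : colon iota (smul iota beta (iset I)) gamma by exact: colon_smul.
have ibI : is_ideal (smul iota beta (iset I)) by exact: smul_ideal.
have [c' _ c'E] := colb c Ic.
have bIc' : smul iota beta (iset I) c' by exists c.
have bg : beta * gamma = 1 by rewrite mulrC.
have c'nzd : GRing.lreg c' := tq_lreg hQ bg cnzd c'E.
have smulgb : smul iota gamma (smul iota beta (iset I)) = iset I.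
  by rewrite smulA// gb smul1.
have intg : integralOver iota gamma by exact: inta.
have leb := integral_colength_le hQ finite ibI bIc' c'nzd colg intg.
have [_ trle] := trace_colengthP M.
have : integralOver iota beta.
  apply: (integral_colength_eq hQ noeth finite ibI bIc' c'nzd colg gb intg).
  apply/le_anti; rewrite leb andbT smulgb lenI.
  have [|g gE] := @linear_smul R M Q iota iota_inj f beta; first by rewrite -fI.
  rewrite fI -gE; exact: trle.
move=> intb; rewrite (_ : alpha = beta * (iota e * a')); last first.
  rewrite /beta [iota a * _]mulrC mulrACA aa mulr1 -deE.
  by rewrite mulrCA [d' * _]mulrC dd mulr1.
by apply: integral_mul intb _; exact: inta.
Qed.

(** Over a discrete valuation ring, scaling by alpha preserves the colength
    exactly when alpha has value zero. *)
Lemma colen_smul_valuation (n : set (Rbar iota)) alpha alpha' (J : set R) :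
  is_dvr n -> is_ideal J -> @finlen R R^o J [set: R] -> colon iota J alpha ->
  alpha * alpha' = 1 ->
  colen (smul iota alpha J) = colen J <-> valuation iota alpha = 0%E.
Proof.
move=> dvr iJ finJ cola aa; have [c Jc cnzd] := finlen_nzd iJ finJ.
have iaJ : is_ideal (smul iota alpha J) by exact: smul_ideal.
have [c' _ c'E] := cola c Jc.
have aJc' : smul iota alpha J c' by exists c.
have c'nzd : GRing.lreg c' := tq_lreg hQ aa cnzd c'E.
have a'a : alpha' * alpha = 1 by rewrite mulrC.
have cola' : colon iota (smul iota alpha J) alpha'.
  by apply: colon_smul; rewrite a'a => x _; exists x => //; rewrite mul1r.
have smula'a : smul iota alpha' (smul iota alpha J) = J.
  by rewrite smulA// a'a smul1.
split=> [eqlen|/(valuation_eq0 hQ dvr)[inta [alpha'' aa'' inta'']]].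
- apply/(valuation_eq0 hQ dvr).
  have [inta|[alpha'' aa'' inta'']] := integral_or_inv hQ dvr alpha.
    split=> //; exists alpha' => //.
    exact: (integral_colength_eq hQ noeth finite iJ Jc cnzd cola aa inta).
  have inta' : integralOver iota alpha'.
    rewrite (_ : alpha' = alpha'')//.
    by rewrite -[alpha']mulr1 -aa'' mulrA a'a mul1r.
  split; last by exists alpha'.
  apply: (integral_colength_eq hQ noeth finite iaJ aJc' c'nzd cola' a'a inta').
  by rewrite smula'a.
- have inta' : integralOver iota alpha'.
    rewrite (_ : alpha' = alpha'')//.
    by rewrite -[alpha']mulr1 -aa'' mulrA a'a mul1r.
  apply/le_anti.
  rewrite (integral_colength_le hQ finite iJ Jc cnzd cola inta) andbT.
  rewrite -{2}smula'a.
  exact: (integral_colength_le hQ finite iaJ aJc' c'nzd cola' inta').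
Qed.

Lemma partial_traces_dvr (n : set (Rbar iota)) (J : set R) : is_dvr n ->
  partial_trace_ideal (ideal_mod I) J ->
  [set iota @` K | K in partial_trace_ideal (ideal_mod I)] =
  [set [set alpha * x | x in iota @` J] |
     alpha in colon iota J `&` [set alpha | valuation iota alpha = 0%E]].
Proof.
move=> dvr /partial_traceP[f [fJ lenJ]].
have [c Ic cnzd] := primary_nzd.
have [_ trle] := trace_colengthP (ideal_mod I).
have [N lenI] := finlenP iI (@subsetT _ _) (finite iI Ic cnzd).
have fin_trace (K : set R) : colen K = trace_colength (ideal_mod I) ->
    @finlen R R^o K [set: R].
  move=> KE; apply: (@colen_finlen R K N).
  by rewrite KE -(colen_haslen lenI) -(range_val I) trle.
(* A partial trace ideal is a multiple of I by a unit of Q. *)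
have scaleI (g : {linear ideal_mod I -> R^o}) :
    colen (range g) = trace_colength (ideal_mod I) ->
    exists beta beta', [/\ colon iota (iset I) beta,
      range g = smul iota beta (iset I) & beta * beta' = 1].
  move=> gE; have [beta colb gb] := linear_idealE hQ g Ic cnzd.
  have [t + tnzd] := finlen_nzd (ideal_im g) (fin_trace _ gE).
  rewrite gb => -[x Ix tE]; have [t' tt] := tq_unit hQ tnzd.
  by exists beta, (iota x * t'); split=> //; rewrite mulrA -tE.
rewrite fJ in lenJ; have [a0 [a0' [col0 J0 aa0]]] := scaleI f lenJ.
have iJ : is_ideal J by rewrite fJ; exact: ideal_im.
rewrite -fJ in lenJ J0.
have finJ := fin_trace J lenJ.
apply/seteqP.
split=> [_ [K /partial_traceP[g [gK lenK]] <-]|_ [alpha [cola v0] <-]].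
- rewrite gK in lenK; have [b [b' [colb Kb bb]]] := scaleI g lenK.
  rewrite -gK in lenK Kb.
  pose alpha := b * a0'.
  have aE : alpha * a0 = b by rewrite /alpha -mulrA [a0' * _]mulrC aa0 mulr1.
  have KJ : K = smul iota alpha J by rewrite J0 smulA// aE -Kb.
  have cola : colon iota J alpha by rewrite J0; apply: colon_smul; rewrite aE.
  exists alpha; last by rewrite KJ image_smul.
  split=> //; apply/(@colen_smul_valuation n alpha (a0 * b') J) => //.
    by rewrite /alpha [a0 * _]mulrC mulrACA bb mul1r mulrC.
  by rewrite -KJ lenK lenJ.
- have [_ [alpha' aa _]] := (valuation_eq0 hQ dvr alpha).1 v0.
  exists (smul iota alpha J); last exact: image_smul.
  apply/partial_traceP.
  have [|g gE] := @linear_smul R _ Q iota iota_inj f alpha; first by rewrite -fJ.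
  exists g; split; first by rewrite gE -fJ.
  by rewrite -lenJ; apply/(colen_smul_valuation dvr iJ finJ cola aa).
Qed.

End Main.

Theorem theorem1p3 (R : comNzRingType) (m : ideal R)
    (Q : comNzRingType) (iota : {rmorphism R -> Q}) (I : ideal R)
    (hCM : cohen_macaulay_local (iset m))
    (hdim : krull_dim R = 1%:E%E)
    (hQ : is_total_quotient_ring iota)
    (hI : primary_to (iset m) (iset I)) :
  ((forall K : set R, primary_to (iset m) K -> has_principal_reduction K) ->
     ((exists M : lmodType R,
         finitely_generated M /\ partial_trace_ideal M (iset I)) <->
      colon iota (iset I) `<=` [set alpha | alpha \in integral_closure iota]))
  /\
  (forall n : ideal (Rbar iota),
     is_dvr (iset n) -> same_residue_field m n ->
     forall J : set R, partial_trace_ideal (ideal_mod I) J ->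
       [set iota @` K | K in partial_trace_ideal (ideal_mod I)] =
       [set [set alpha * x | x in iota @` J] |
          alpha in colon iota J `&` [set alpha | valuation iota alpha = 0%E]]).
Proof.
split=> [red|n dvr _ J]; last exact: (partial_traces_dvr hCM hdim hQ hI dvr).
split=> [[M [_ trI]]|colI].
  exact: (colon_of_partial_trace hCM hdim hQ hI red trI).
exists (ideal_mod I); split; first by apply: ideal_mod_fg; case: hCM.
exact: (partial_trace_of_colon hCM hdim hQ hI).
Qed.
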